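(* Let $R\ge2$, $K\ge2$, $\alpha\in(0,1]$, $\kappa>0$, $B\ge1$, and let $\mu$ be an $\alpha$-dense piece of $\gamma_R$ on $\mathbb Z^n$. Set $S:=\log(2/\alpha)$ and $\rho:=\frac{100BS^{3/2}\kappa}{\sqrt K}$. Assume $\frac{3\sqrt S}{R}\le\kappa\le\sqrt{\frac{2\pi}{K\ln(8n)}}$ and $Q\ge\frac{2\sqrt{2nS}\,\kappa}{\rho}$. Then there exist $\eta_1,\dots,\eta_\ell\in Q^{-1}\mathbb Z^n\cap[-1/2,1/2)^n$ with $\ell\le\frac{2S}{\log_2(2B)}$ such that every $\zeta\in\Lambda_K(\mu)$ with $\|\zeta\|_{\mathbb T^n}\le\kappa$ satisfies $\operatorname{dist}_{\mathbb T^n}(\zeta,\operatorname{span}_{\mathbb R}\{\eta_1,\dots,\eta_\ell\})\le 2\rho$, where $\operatorname{span}_{\mathbb R}\{\eta_1,\dots,\eta_\ell\}$ is viewed as a subtorus of $\mathbb T^n$.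
   Context: $\log$ is base two, $\ln$ natural. $\mathbb T^n=(\mathbb R/\mathbb Z)^n$; $\|\zeta\|_{\mathbb T^n}$ is the Euclidean distance to $\mathbb Z^n$; $\operatorname{dist}_{\mathbb T^n}(\zeta,W)=\inf_{w\in W}\|\zeta-w\|_{\mathbb T^n}$ for the image $W$ of a real subspace in $\mathbb T^n$. $\widehat\mu(\zeta)=\sum_x\mu(x)e^{-2\pi i\langle\zeta,x\rangle}$; $\Lambda_K(\mu)=\{\zeta:|\widehat\mu(\zeta)|\ge1-1/K\}$. $\gamma_R(x)=e^{-\pi\|x\|_2^2/R^2}/\sum_{y\in\mathbb Z^n}e^{-\pi\|y\|_2^2/R^2}$. $\mu$ is an $\alpha$-dense piece of $\nu$ if $\mu(x)\le\alpha^{-1}\nu(x)$ for all $x$. *)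

(* Defs.v *)
From HB Require Import structures.
From mathcomp Require Import all_boot all_order all_algebra.
From mathcomp Require Import all_classical all_reals all_analysis.
From mathcomp Require Import complex.

Set Implicit Arguments.
Unset Strict Implicit.
Unset Printing Implicit Defensive.

Import Order.TTheory GRing.Theory Num.Theory.

Local Open Scope classical_set_scope.
Local Open Scope ring_scope.

Section Defs.
Context {R : realType}.

Definition log2 (x : R) : R := ln x / ln 2.

(* Infinite sums over an index set T, for absolutely summable families:
   f^\+ and f^\- are the positive and negative parts, and \esum is the
   (order-independent) sum of a nonnegative family. *)
Definition rsum (T : choiceType) (f : T -> R) : R :=
  fine (\esum_(x in [set: T]) (f^\+ x)%:E)
  - fine (\esum_(x in [set: T]) (f^\- x)%:E).

Definition csum (T : choiceType) (f : T -> R[i]) : R[i] :=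
  (rsum (fun x => complex.Re (f x)) +i* rsum (fun x => complex.Im (f x)))%C.

(* exp (i t) *)
Definition expi (t : R) : R[i] := (cos t +i* sin t)%C.

Section Dim.
Variable n : nat.

Definition intvec (z : 'rV[int]_n) : 'rV[R]_n := map_mx intr z.

Definition dotv (u v : 'rV[R]_n) : R := \sum_(j < n) u 0 j * v 0 j.

(* The library norm on 'rV[R]_n is the sup norm, hence this definition. *)
Definition norm2 (v : 'rV[R]_n) : R := Num.sqrt (\sum_(j < n) v 0 j ^+ 2).

(* Points of the torus (R/Z)^n are given by representatives in R^n; everything
   below is invariant under translation of the representatives by Z^n
   (torus_norm_periodic, torus_dist_periodic, fourier_periodic). *)
Definition torus_norm (zeta : 'rV[R]_n) : R :=
  inf [set norm2 (zeta - intvec z) | z in [set: 'rV[int]_n]].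

(* Distance to the image of W in the torus. *)
Definition torus_dist (zeta : 'rV[R]_n) (W : {vspace 'rV[R]_n}) : R :=
  inf [set torus_norm (zeta - w) | w in [set w | w \in W]].

(* Probability measures on Z^n are given by their mass functions. *)
Definition prob_mass (mu : 'rV[int]_n -> R) : Prop :=
  (forall x, 0 <= mu x) /\
  \esum_(x in [set: 'rV[int]_n]) (mu x)%:E = 1%:E.

Definition fourier (mu : 'rV[int]_n -> R) (zeta : 'rV[R]_n) : R[i] :=
  csum (fun x => (mu x)%:C%C * expi (- (2 * pi * dotv zeta (intvec x)))).

Definition large_spectrum (K : R) (mu : 'rV[int]_n -> R) : set 'rV[R]_n :=
  [set zeta | 1 - 1 / K <= Normc.normc (fourier mu zeta)].

Definition gauss_weight (r : R) (x : 'rV[int]_n) : R :=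
  expR (- (pi * norm2 (intvec x) ^+ 2 / r ^+ 2)).

Definition discrete_gaussian (r : R) (x : 'rV[int]_n) : R :=
  gauss_weight r x /
  fine (\esum_(y in [set: 'rV[int]_n]) (gauss_weight r y)%:E).

Definition dense_piece (alpha : R) (mu nu : 'rV[int]_n -> R) : Prop :=
  forall x, mu x <= alpha^-1 * nu x.

(* Q^-1 Z^n \cap [-1/2, 1/2)^n *)
Definition cube_grid (Q : R) : set 'rV[R]_n :=
  [set v | (exists z : 'rV[int]_n, v = Q^-1 *: intvec z) /\
           (forall j, - (1 / 2) <= v 0 j < 1 / 2)].

Lemma torus_norm_periodic (zeta : 'rV[R]_n) (z : 'rV[int]_n) :
  torus_norm (zeta + intvec z) = torus_norm zeta.
Proof.
have intvecB a b : intvec (a - b) = intvec a - intvec b.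
  by rewrite /intvec map_mxB.
rewrite /torus_norm; congr inf; apply/seteqP; split => _ [a _ <-] /=.
- exists (a - z) => //; congr norm2.
  by rewrite intvecB opprB addrA.
- exists (a + z) => //; congr norm2.
  by rewrite -[z in intvec (a + z)]opprK intvecB [intvec (- z)]map_mxN;
     rewrite !opprD !opprK -/(intvec z) addrACA subrr addr0.
Qed.

Lemma torus_dist_periodic (zeta : 'rV[R]_n) (z : 'rV[int]_n)
    (W : {vspace 'rV[R]_n}) :
  torus_dist (zeta + intvec z) W = torus_dist zeta W.
Proof.
rewrite /torus_dist; congr inf; apply: eq_imagel => w _.
by rewrite addrAC torus_norm_periodic.
Qed.

Lemma fourier_periodic (mu : 'rV[int]_n -> R) (zeta : 'rV[R]_n)
    (z : 'rV[int]_n) :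
  fourier mu (zeta + intvec z) = fourier mu zeta.
Proof.
rewrite /fourier; congr csum; apply/funext => x; congr (_ * _).
have -> : dotv (zeta + intvec z) (intvec x) =
    dotv zeta (intvec x) + (\sum_(j < n) z 0 j * x 0 j)%:~R.
  rewrite /dotv rmorph_sum -big_split /=; apply: eq_bigr => j _.
  by rewrite !mxE mulrDl intrM.
set m := \sum_(j < n) _; set t := dotv _ _.
have cosZ (k : nat) (s : R) :
    cos (s + 2 * pi * k%:R) = cos s /\ sin (s + 2 * pi * k%:R) = sin s.
  elim: k => [|k [ihc ihs]]; first by rewrite mulr0 addr0.
  have -> : s + 2 * pi * k.+1%:R = (s + 2 * pi * k%:R) + pi *+ 2.
    by rewrite -(natr1 k) mulrDr mulr1 addrA [2 * pi]mulr_natl.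
  by rewrite cosD2pi sinD2pi.
have expiZ (k : nat) (s : R) : expi (s + 2 * pi * k%:R) = expi s.
  by rewrite /expi; have [-> ->] := cosZ k s.
rewrite mulrDr opprD; case: m => k.
  by rewrite -[LHS](expiZ k) -addrA [_ + 2 * pi * _]addrC subrr addr0.
by rewrite NegzE rmorphN /= mulrN opprK expiZ.
Qed.

End Dim.
End Defs.

(* Main.v *)
Require Import Defs.
From mathcomp Require Import all_boot all_order all_algebra.
From mathcomp Require Import all_classical all_reals all_analysis.
From mathcomp Require Import complex zify ring lra.

Set Implicit Arguments.
Unset Strict Implicit.
Unset Printing Implicit Defensive.

Import Order.TTheory GRing.Theory Num.Theory.
Import numFieldNormedType.Exports.

Local Open Scope classical_set_scope.
Local Open Scope ring_scope.

(** Let [z_1, ..., z_m] be points of the large spectrum, of norm at most about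
    [kappa], each at distance more than [rho] from the span of the previous
    ones. Every [<z_i, x>] is then nearly constant modulo 1 for most [x] under
    [mu], so the product [F] over [i] of the Fejer kernels of degree
    [L ~ sqrt K / m] in [<z_i, x>] has [mu]-mean at least 2/3, whence its mean
    under the discrete Gaussian is at least of order [alpha]. Expanding [F],
    the latter is at most an average of [|gamma_r^(\sum_i k_i z_i)|] over
    integers [|k_i| < L], and the Gaussian decay of [gamma_r^] together with the
    separation makes it at most [(2 B)^-m]. Hence [m <= S / log2 (2 B)], a
    greedy choice of the [z_i] stops, and rounding a multiple of the
    Gram-Schmidt basis of their span gives the [eta_i].

    The decay of [gamma_r^] comes from a finite form of the Jacobi triple
    product: [gamma_r] is a limit of measures on boxes whose one-dimensional
    generating function is [\prod_(j < 2 N) (1 + x p^j)] up to rescaling, each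
    factor of which contributes decay. *)

(** * Elementary inequalities for lattice sums, the cosine and products *)

Section RealBounds.
Context {R : realType}.
Implicit Types (x y h t : R).

(** Telescoping replaces an integral: [Psi] takes values in [[-2, 2]] and has slope
    [2 / (1 + |y|)^2], which is at least [g y] because [(1 + |y|)^2 <= 2 (1 + y^2)]. The increments
    of [Psi] thus pay for [h g] and add up to at most 4. *)
Lemma sum_lattice_cauchy_le (t h : R) (L : nat) : 0 < h ->
  \sum_(k < L) (1 + (t + k%:R * h) ^+ 2)^-1 <= 2 + 4 / h.
Proof.
move=> h0.
pose g y : R := (1 + y ^+ 2)^-1.
pose Psi y : R := 2 * y / (1 + `|y|).
pose M y : R := if y < 0 then 2 else g y.
have q0 y : 0 < 1 + y ^+ 2 by have := sqr_ge0 y; lra.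
have g0 y : 0 < g y by rewrite invr_gt0.
have g1 y : g y <= 1 by rewrite invf_le1 // lerDl sqr_ge0.
have stepP y : 0 <= y -> h * g (y + h) <= Psi (y + h) - Psi y.
  move=> y0; rewrite /Psi !ger0_norm; [|lra|lra].
  have -> : 2 * (y + h) / (1 + (y + h)) - 2 * y / (1 + y) =
     2 * h / ((1 + y) * (1 + (y + h))).
    field; apply/andP; split; apply/eqP; lra.
  rewrite /g ler_pdivrMr // mulrAC ler_pdivlMr; last by apply: mulr_gt0; lra.
  rewrite [2 * h]mulrC -!mulrA ler_pM2l //.
  have -> : 2 * (1 + (y + h) ^+ 2) = (1 + (y+h))^+2 + (1 - (y+h))^+2 by ring.
  have := sqr_ge0 (1 - (y + h)).
  suff : (1 + y) * (1 + (y + h)) <= (1 + (y + h)) ^+ 2 by lra.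
  by rewrite expr2 ler_pM2r; lra.
have PsiN y : Psi (- y) = - Psi y by rewrite /Psi normrN mulrN mulNr.
have stepN y : y <= - h -> h * g y <= Psi (y + h) - Psi y.
  move=> yh; have := stepP (- (y + h)).
  rewrite [- (y + h) + h](_ : _ = - y); last by ring.
  rewrite !PsiN /g sqrrN => /(_ ltac:(lra)); lra.
have Psi_mono y : Psi y <= Psi (y + h).
  have [y0|y0] := leP 0 y.
    by have := stepP _ y0; have := mulr_gt0 h0 (g0 (y + h)); lra.
  have [yh|yh] := leP y (- h).
    by have := stepN _ yh; have := mulr_gt0 h0 (g0 y); lra.
  have : Psi y <= 0 by rewrite /Psi pmulr_lle0 ?invr_gt0; have := normr_ge0 y; lra.
  have : 0 <= Psi (y + h).
    by rewrite /Psi pmulr_lge0 ?invr_gt0; have := normr_ge0 (y + h); lra.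
  lra.
(* The increment of [Psi] controls [g] only at the endpoint farther from 0. For [y >= 0] the term in
   [M] moves the bound from [y + h] to [y]; a step across 0 is paid by the drop of [M] from 2 to at
   most 1. *)
have step y : h * g y <= Psi (y + h) - Psi y + h * (M y - M (y + h)).
  rewrite /M; have [y0|y0] := ltP y 0; last first.
    rewrite ltNge (_ : 0 <= y + h) /=; last by lra.
    by have := stepP _ y0; rewrite mulrBr; lra.
  case: ltP => yh.
    by rewrite subrr mulr0 addr0; apply: stepN; lra.
  have := Psi_mono y; have : h * g y <= h by rewrite ger_pMr.
  have : h * g (y + h) <= h by rewrite ger_pMr.
  rewrite mulrBr; lra.
have Psi2 y : - 2 <= Psi y <= 2.
  have n0 := normr_ge0 y; rewrite -ler_norml /Psi !normrM normfV (@ger0_norm _ 2) //.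
  rewrite (@ger0_norm _ (1 + _)) ?ler_pdivrMr; lra.
have M02 y : 0 <= M y <= 2.
  rewrite /M; case: ifP => _; first lra.
  by have := g0 y; have := g1 y; lra.
have tele : h * \sum_(k < L) g (t + k%:R * h) <=
    Psi (t + L%:R * h) - Psi t + h * (M t - M (t + L%:R * h)).
  elim: L => [|L IH]; first by rewrite big_ord0 !mul0r !addr0 !subrr !mulr0 addr0.
  rewrite big_ord_recr /= mulrDr; have := step (t + L%:R * h).
  have -> : t + L.+1%:R * h = t + L%:R * h + h by rewrite -natr1; ring.
  move: IH; rewrite !mulrBr; lra.
rewrite -(ler_pM2l h0); apply: (le_trans tele).
have -> : h * (2 + 4 / h) = h * 2 + 4 by field; apply/eqP; lra.
have : h * (M t - M (t + L%:R * h)) <= h * 2.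
  by rewrite ler_pM2l //; have := M02 t; have := M02 (t + L%:R * h); lra.
have := Psi2 t; have := Psi2 (t + L%:R * h); lra.
Qed.

Lemma expRN_sqr_le (y : R) : expR (- y ^+ 2) <= (1 + y ^+ 2)^-1.
Proof.
have ? := sqr_ge0 y.
by rewrite expRN lef_pV2 ?expR_ge1Dx // qualifE /= ?expR_gt0 //; lra.
Qed.

Lemma sum_lattice_gauss_le (a t d : R) (L : nat) : 0 < a -> 0 < d ->
  \sum_(k < L) expR (- (a * (t + k%:R * d) ^+ 2)) <= 2 + 4 / (Num.sqrt a * d).
Proof.
move=> a0 d0; have s0 : 0 < Num.sqrt a by rewrite sqrtr_gt0.
apply: le_trans (sum_lattice_cauchy_le (Num.sqrt a * t) L (mulr_gt0 s0 d0)).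
apply: ler_sum => k _.
have -> : Num.sqrt a * t + k%:R * (Num.sqrt a * d) = Num.sqrt a * (t + k%:R * d) by ring.
by rewrite -[a in - (a * _)](sqr_sqrtr (ltW a0)) -exprMn expRN_sqr_le.
Qed.

(** The difference vanishes at 0 and has derivative [z sin z], nonnegative on [[0, pi]]. *)
Lemma sinx_ge_xcosx (x : R) : 0 <= x <= pi -> x * cos x <= sin x.
Proof.
move=> /andP[x0 xpi].
pose f : R -> R := fun z => sin z - z * cos z.
have df z : is_derive z (1:R) f (z * sin z).
  rewrite /f; apply: is_derive_eq.
  rewrite /GRing.scale /=; ring.
have cf : {within `[0, x], continuous f}.
  apply: continuous_subspaceT => z; apply: differentiable_continuous.
  by apply/derivable1_diffP; have [] := df z.
have [c] := MVT_segment x0 (fun z _ => df z) cf.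
rewrite in_itv /= => /andP[c0 cx] fx.
suff : 0 <= f x - f 0 by rewrite /f sin0 mul0r subrr subr0 subr_ge0.
rewrite fx subr0; apply: mulr_ge0 => //; apply: mulr_ge0 => //.
by apply: sin_ge0_pi; rewrite c0 (le_trans cx).
Qed.

(** For [|t| <= 1/4] the right side is [2 sin^2 (pi t) >= 2 (pi t)^2 cos^2 (pi t) >= (pi t)^2], as
    [cos^2 (pi t) >= 1/2] there. For larger [|t|] the cosine is nonpositive while [4 t^2 <= 1]. *)
Lemma one_sub_cos2pi_ge (t : R) : `|t| <= 1 / 2 -> 4 * t ^+ 2 <= 1 - cos (2 * pi * t).
Proof.
have pi2 := @pi_ge2 R.
wlog t0 : t / 0 <= t.
  move=> H; have [/H//|t0] := leP 0 t.
  by rewrite -normrN => /H; rewrite sqrrN mulrN cosN; apply; lra.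
rewrite ger0_norm // => t2.
have [t4|t4] := leP t (1 / 4).
  have xpi : 0 <= pi * t <= pi.
    by rewrite mulr_ge0 ?pi_ge0 //= ger_pMr ?pi_gt0 //; lra.
  have pt : pi * t <= pi / 4 by rewrite ler_pM2l ?pi_gt0 //; lra.
  have c0 : 0 <= cos (pi * t).
    by apply: cos_ge0_pihalf; case/andP: xpi => ? ?; apply/andP; split; lra.
  have c20 : 0 <= cos (2 * pi * t).
    by apply: cos_ge0_pihalf; case/andP: xpi => ? ?; apply/andP; split; lra.
  have E : cos (2 * pi * t) = cos (pi * t) ^+ 2 *+ 2 - 1.
    have -> : 2 * pi * t = pi * t + pi * t by ring.
    by rewrite cosD -!expr2 sin2cos2; ring.
  have := sinx_ge_xcosx xpi; have := cos2Dsin2 (pi * t).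
  move: E c20 c0; set c := cos (pi * t); set s := sin (pi * t).
  move=> -> c20 c0 cs xs.
  have h1 : (pi * t * c) ^+ 2 <= s ^+ 2.
    rewrite ler_sqr // ?qualifE /=; case/andP: xpi => ? ?; first by apply: mulr_ge0.
    by apply: le_trans xs; apply: mulr_ge0.
  have h2 : 4 * t ^+ 2 <= (pi * t) ^+ 2.
    rewrite exprMn ler_wpM2r ?sqr_ge0 //.
    have -> : 4 = 2 ^+ 2 :> R by rewrite expr2; lra.
    by rewrite ler_sqr // qualifE /=; lra.
  have h3 : (pi * t) ^+ 2 * (1 / 2) <= (pi * t) ^+ 2 * c ^+ 2.
    by rewrite ler_wpM2l ?sqr_ge0 //; lra.
  rewrite exprMn in h1; lra.
have : cos (2 * pi * t) <= 0.
  have -> : 2 * pi * t = (2 * pi * t - pi) + pi by ring.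
  rewrite cosDpi oppr_le0; apply: cos_ge0_pihalf.
  have h1 : pi * (1 / 4) <= pi * t by rewrite ler_pM2l ?pi_gt0 //; lra.
  have h2 : pi * t <= pi * (1 / 2) by rewrite ler_pM2l ?pi_gt0 //; lra.
  by apply/andP; split; lra.
have : t ^+ 2 <= (1 / 2) ^+ 2 by rewrite ler_sqr // qualifE /=; lra.
rewrite (_ : (1 / 2) ^+ 2 = 1 / 4 :> R); last by field.
lra.
Qed.

Lemma prod_ge_1Bsum (I : Type) (s : seq I) (P : I -> R) :
  (forall i, 0 <= P i <= 1) -> 1 - \sum_(i <- s) (1 - P i) <= \prod_(i <- s) P i.
Proof.
move=> P01; elim: s => [|i s IH]; first by rewrite !big_nil; lra.
rewrite !big_cons; have /andP[P0 P1] := P01 i.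
have S0 : 0 <= \sum_(j <- s) (1 - P j).
  by apply: sumr_ge0 => j _; rewrite subr_ge0; case/andP: (P01 j).
have : P i * (1 - \sum_(j <- s) (1 - P j)) <= P i * \prod_(j <- s) P j.
  exact: ler_wpM2l.
have : P i * \sum_(j <- s) (1 - P j) <= \sum_(j <- s) (1 - P j).
  exact: ler_piMl.
lra.
Qed.
End RealBounds.

(** * Finite q-binomial theorem and Gaussian shape of its coefficients *)

Section QBinomial.
Context {R : realType}.
Implicit Types (p q : R) (M N k l : nat).

(* The coefficient of [X^k] in [\prod_(j < M) (1 + p^j X)], that is,
   [p^(k (k - 1) / 2)] times a Gaussian binomial coefficient. *)
Fixpoint qbin p M k : R :=
  match M, k with
  | _, 0%N => 1
  | 0%N, _.+1 => 0
  | M'.+1, k'.+1 => qbin p M' k'.+1 + p ^+ M' * qbin p M' k'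
  end.

Lemma qbinx0 p M : qbin p M 0 = 1. Proof. by case: M. Qed.

Lemma qbin_small p M k : (M < k)%N -> qbin p M k = 0.
Proof.
elim: M k => [|M IH] [|k] //= Mk.
by rewrite !IH ?mulr0 ?addr0 // (ltn_trans _ Mk).
Qed.

Lemma qbin_gt0 p M k : 0 < p -> (k <= M)%N -> 0 < qbin p M k.
Proof.
move=> p0; have ge0 M' k' : 0 <= qbin p M' k'.
  elim: M' k' => [|M' IH] [|k'] //=; rewrite addr_ge0 // mulr_ge0 //.
  by rewrite exprn_ge0 // ltW.
elim: M k => [|M IH] [|k] //= kM; rewrite ltr_wpDl // mulr_gt0 ?exprn_gt0 ?IH //.
Qed.

(** The morphism lets one identity serve both at a real point, for the total mass, and at a complex
    point, for the characteristic function. *)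
Lemma qbin_prod (T : comNzRingType) (f : {rmorphism R -> T}) p M (x : T) :
  \sum_(k < M.+1) f (qbin p M k) * x ^+ k = \prod_(j < M) (1 + x * f (p ^+ j)).
Proof.
elim: M => [|M IH]; first by rewrite big_ord0 big_ord1 /= rmorph1 mul1r.
rewrite [RHS]big_ord_recr /= -IH big_ord_recl /= rmorph1 mul1r.
under eq_bigr do rewrite /bump /= add1n rmorphD rmorphM mulrDl.
rewrite big_split /= addrA mulrDr mulr1; congr (_ + _).
  rewrite big_ord_recr /= qbin_small // rmorph0 mul0r addr0.
  rewrite [RHS]big_ord_recl /= qbinx0 rmorph1 mul1r; congr (_ + _).
rewrite mulr_suml; apply: eq_bigr => k _; rewrite exprS; ring.
Qed.

(** With [P] the generating product, this is the coefficient of [X^(k+1)] in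
    [(1 + X) P(p X) = (1 + p^M X) P(X)]; the induction uses the Pascal recursion instead. *)
Lemma qbin_ratio p M k :
  qbin p M k.+1 * (1 - p ^+ k.+1) = qbin p M k * (p ^+ k - p ^+ M).
Proof.
elim: M k => [|M IH] k.
  by case: k => [|k] /=; rewrite ?mul0r // mul1r !expr0 subrr.
have -> : qbin p M.+1 k.+1 = qbin p M k.+1 + p ^+ M * qbin p M k by [].
rewrite mulrDl IH; case: k => [|k]; first by rewrite !qbinx0 !exprS expr0; ring.
have -> : qbin p M.+1 k.+1 = qbin p M k.+1 + p ^+ M * qbin p M k by [].
have /(congr1 (fun y => p ^+ M.+1 * y)) := IH k; rewrite !exprS => E.
apply/eqP; rewrite -subr_eq0; apply/eqP.
transitivity (p * p ^+ M * (qbin p M k.+1 * (1 - p * p ^+ k)) -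
  p * p ^+ M * (qbin p M k * (p ^+ k - p ^+ M))); first by ring.
by rewrite E subrr.
Qed.

(** The exponents [2 l + 1] add up to [l^2], and each quotient of the two corrections is at most 1
    because [N - l <= N + l + 1]. *)
Lemma quasi_gauss_le q N (u : nat -> R) : 0 < q < 1 -> (forall l, (l <= N)%N -> 0 < u l) ->
  (forall l, (l < N)%N -> u l.+1 * (1 - (q ^+ 2) ^+ (N + l.+1)) =
     u l * q ^+ (l.*2.+1) * (1 - (q ^+ 2) ^+ (N - l))) ->
  forall l, (l <= N)%N -> u l <= u 0%N * q ^+ (l ^ 2).
Proof.
move=> /andP[q0 q1] u0 uS; elim=> [|l IH] lN; first by rewrite expr0 mulr1.
have p01 k : 0 <= (q ^+ 2) ^+ k by rewrite !exprn_ge0 // ltW.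
have p1 : q ^+ 2 < 1 by rewrite exprn_ilt1 // ltW.
have D0 : 0 < 1 - (q ^+ 2) ^+ (N + l.+1).
  by rewrite subr_gt0 exprn_ilt1 ?exprn_ge0 ?(ltW q0) // addnS.
have -> : (l.+1 ^ 2 = l ^ 2 + l.*2.+1)%N by nia.
rewrite -(ler_pM2r D0) uS // exprD mulrA.
apply: ler_pM; rewrite ?mulr_ge0 ?exprn_ge0 ?(ltW q0) ?(ltW (u0 _ _)) //.
- exact: ltnW.
- by rewrite subr_ge0 exprn_ile1 ?exprn_ge0 ?(ltW q0) ?(ltW p1).
- by rewrite ler_pM2r ?exprn_gt0 // IH // ltnW.
- rewrite lerD2l lerN2 ler_wiXn2l ?exprn_ge0 ?(ltW q0) ?(ltW p1) //.
  by rewrite (leq_trans (leq_subr _ _)) // leq_addr.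
Qed.

(** In the same recurrence the denominators are at most 1, and for [l < N0] each numerator is at
    least [1 - q^(2 (N - N0))]. *)
Lemma quasi_gauss_ge q N N0 (u : nat -> R) : 0 < q < 1 -> (N0 <= N)%N ->
  (forall l, (l <= N)%N -> 0 < u l) ->
  (forall l, (l < N)%N -> u l.+1 * (1 - (q ^+ 2) ^+ (N + l.+1)) =
     u l * q ^+ (l.*2.+1) * (1 - (q ^+ 2) ^+ (N - l))) ->
  forall l, (l <= N0)%N ->
  u 0%N * q ^+ (l ^ 2) * (1 - (q ^+ 2) ^+ (N - N0)) ^+ l <= u l.
Proof.
move=> /andP[q0 q1] N0N u0 uS; elim=> [|l IH] lN; first by rewrite !expr0 !mulr1.
have p1 : q ^+ 2 < 1 by rewrite exprn_ilt1 // ltW.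
have p0 : 0 <= q ^+ 2 by rewrite exprn_ge0 // ltW.
have D0 : 0 < 1 - (q ^+ 2) ^+ (N + l.+1).
  by rewrite subr_gt0 exprn_ilt1 // addnS.
have lN' : (l < N)%N by apply: leq_trans N0N.
have D1 : 1 - (q ^+ 2) ^+ (N + l.+1) <= 1 by rewrite gerBl exprn_ge0.
have E0 : 0 <= 1 - (q ^+ 2) ^+ (N - N0) by rewrite subr_ge0 exprn_ile1 // ltW.
have -> : (l.+1 ^ 2 = l ^ 2 + l.*2.+1)%N by nia.
have step : u l.+1 * (1 - (q ^+ 2) ^+ (N + l.+1)) <= u l.+1.
  by rewrite ger_pMr // u0.
apply: le_trans step; rewrite uS // exprD (exprSr (1 - _)).
have -> (a b c d e : R) : a * (b * c) * (d * e) = a * b * d * c * e by ring.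
apply: ler_pM => //.
- by rewrite !mulr_ge0 ?exprn_ge0 ?(ltW q0) ?(ltW (u0 _ _)).
- by rewrite ler_pM2r ?exprn_gt0 // IH // ltnW.
- rewrite lerD2l lerN2 ler_wiXn2l ?(ltW p1) //.
  by rewrite leq_sub2l // ltnW.
Qed.

End QBinomial.

(** * One-dimensional weights from the finite Jacobi product *)

Section ThetaWeights.
Context {R : realType}.
Implicit Types (q : R) (N k l : nat).
Local Notation normc := (@Normc.normc R).

Lemma normc_ge0 (z : R[i]) : 0 <= normc z.
Proof. by case: z => a b; rewrite sqrtr_ge0. Qed.

Lemma normc_real (x : R) : normc (x%:C)%C = `|x|.
Proof. by rewrite /= expr0n addr0 sqrtr_sqr. Qed.

Lemma ler_normc_sum (I : Type) (s : seq I) (F : I -> R[i]) :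
  normc (\sum_(i <- s) F i) <= \sum_(i <- s) normc (F i).
Proof.
elim: s => [|i s IH]; first by rewrite !big_nil Normc.normc0.
by rewrite !big_cons; apply: le_trans (le_normcD _ _) _; rewrite lerD2l.
Qed.

Lemma normc_prod (I : Type) (s : seq I) (F : I -> R[i]) :
  normc (\prod_(i <- s) F i) = \prod_(i <- s) normc (F i).
Proof.
elim: s => [|i s IH]; first by rewrite !big_nil Normc.normc1.
by rewrite !big_cons Normc.normcM IH.
Qed.

Lemma normcX (z : R[i]) k : normc (z ^+ k) = normc z ^+ k.
Proof. by elim: k => [|k IH]; rewrite ?expr0 ?Normc.normc1 // !exprS Normc.normcM IH. Qed.

Lemma normc2E (z : R[i]) : normc z ^+ 2 = complex.Re z ^+ 2 + complex.Im z ^+ 2.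
Proof. by case: z => a b /=; rewrite sqr_sqrtr // addr_ge0 ?sqr_ge0. Qed.

Lemma normc_1Dscale (z : R[i]) (r : R) : normc z = 1 -> 0 < r ->
  normc (1 + z * (r%:C)%C) <= 1 + r.
Proof.
move=> z1 r0; apply: le_trans (le_normcD _ _) _.
by rewrite Normc.normc1 Normc.normcM z1 mul1r normc_real gtr0_norm.
Qed.

(** Here [|1 + r z|^2 = (1 + r)^2 - 2 r (1 - Re z)]. Since [(1 + r)^2 <= 4], this is at most
    [(1 + r)^2 (1 - r (1 - Re z) / 2)], and [1 - x <= exp (- x)] concludes. *)
Lemma normc_1Dscale_exp (z : R[i]) (r : R) : normc z = 1 -> 0 < r <= 1 ->
  normc (1 + z * (r%:C)%C) <= (1 + r) * expR (- (r / 4 * (1 - complex.Re z))).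
Proof.
move=> z1 /andP[r0 r1].
have rez : complex.Re z ^+ 2 + complex.Im z ^+ 2 = 1 by rewrite -normc2E z1 expr1n.
rewrite -ler_sqr ?qualifE /= ?normc_ge0 //; last by rewrite mulr_ge0 ?expR_ge0 //; lra.
rewrite exprMn -expRM_natl mulrN normc2E.
have -> : complex.Re (1 + z * (r%:C)%C) = 1 + complex.Re z * r.
  by case: z {z1 rez} => a b /=; rewrite mulr0 subr0.
have -> : complex.Im (1 + z * (r%:C)%C) = complex.Im z * r.
  by case: z {z1 rez} => a b /=; rewrite mulr0 !add0r.
set a := complex.Re z in rez *; set b := complex.Im z in rez *.
have a1 : a <= 1 by have := sqr_ge0 b; rewrite leNgt => bb; apply/negP => ?; nra.
have -> : (1 + a * r) ^+ 2 + (b * r) ^+ 2 = 1 + 2 * a * r + (a ^+ 2 + b ^+ 2) * r ^+ 2.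
  by ring.
rewrite rez mul1r.
have e1 : 1 - 2 * (r / 4 * (1 - a)) <= expR (- (2 * (r / 4 * (1 - a)))).
  exact: expR_ge1Dx.
apply: (@le_trans _ _ ((1 + r) ^+ 2 * (1 - 2 * (r / 4 * (1 - a))))); last first.
  by rewrite ler_wpM2l ?sqr_ge0.
have -> : (1 + r) ^+ 2 * (1 - 2 * (r / 4 * (1 - a))) =
  1 + 2 * r + r ^+ 2 - (1 + r) ^+ 2 / 4 * (2 * (r * (1 - a))) by field.
have h1 : 0 <= r * (1 - a) by rewrite mulr_ge0 //; lra.
have h2 : (1 + r) ^+ 2 / 4 <= 1.
  have : (1 + r) ^+ 2 <= 2 ^+ 2 by rewrite ler_sqr ?qualifE /=; lra.
  lra.
have : (1 + r) ^+ 2 / 4 * (2 * (r * (1 - a))) <= 2 * (r * (1 - a)).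
  by apply: ler_piMl => //; lra.
lra.
Qed.

Variables (q : R) (N : nat).
Hypotheses (q01 : 0 < q < 1) (N0 : (0 < N)%N).

Let q0 : 0 < q. Proof. by case/andP: q01. Qed.
Let q1 : q < 1. Proof. by case/andP: q01. Qed.
(** The rescaling that centres the coefficients at [N]: it turns [(q^2)^j] into [q^(2 (j - N) + 1)],
    the odd powers of [q] in the Jacobi product. *)
Let X := (q^-1) ^+ (N.*2.-1).
Let X0 : 0 < X. Proof. by rewrite exprn_gt0 // invr_gt0. Qed.
Let b k := qbin (q ^+ 2) N.*2 k * X ^+ k.
Let b0 k : (k <= N.*2)%N -> 0 < b k.
Proof.
move=> kN; apply: mulr_gt0; last exact: exprn_gt0.
by apply: qbin_gt0 => //; exact: exprn_gt0.
Qed.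

Lemma theta_shift k l : (l.*2.+1 + N.*2.-1 = k.*2)%N -> X * (q ^+ 2) ^+ k = q ^+ l.*2.+1.
Proof.
move=> E; rewrite -exprM mul2n -E exprD mulrCA -exprMn mulVf ?gt_eqF //.
by rewrite expr1n mulr1.
Qed.

(** Normalised to be 1 at the centre: for fixed [l] and growing [N], the weight at [N + l] or
    [N - l] tends to [q^(l^2)], while the generating function stays a finite product. *)
Definition theta_wt k : R := b k / b N.

Lemma theta_wt_gt0 k : (k <= N.*2)%N -> 0 < theta_wt k.
Proof. by move=> kN; rewrite divr_gt0 ?b0 // -addnn leq_addr. Qed.

Let wtN : theta_wt N = 1.
Proof. by rewrite /theta_wt divff // gt_eqF // b0 // -addnn leq_addr. Qed.

Let b_ratio k : (k <= N.*2)%N -> b k.+1 * (1 - (q ^+ 2) ^+ k.+1) =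
  b k * (X * (q ^+ 2) ^+ k) * (1 - (q ^+ 2) ^+ (N.*2 - k)).
Proof.
move=> kN; have := qbin_ratio (q ^+ 2) N.*2 k.
have -> : (q ^+ 2) ^+ N.*2 = (q ^+ 2) ^+ k * (q ^+ 2) ^+ (N.*2 - k).
  by rewrite -exprD subnKC.
by rewrite /b => E; rewrite mulrAC E (exprS X); ring.
Qed.

Lemma theta_wt_up l : (l < N)%N ->
  theta_wt (N + l.+1) * (1 - (q ^+ 2) ^+ (N + l.+1)) =
  theta_wt (N + l) * q ^+ (l.*2.+1) * (1 - (q ^+ 2) ^+ (N - l)).
Proof.
move=> lN; rewrite /theta_wt addnS.
have := @b_ratio (N + l) ltac:(lia); rewrite (@theta_shift _ l); last by lia.
rewrite (_ : (N.*2 - (N + l) = N - l)%N); last by lia.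
by move=> E; rewrite mulrAC E; ring.
Qed.

Lemma theta_wt_down l : (l < N)%N ->
  theta_wt (N - l.+1) * (1 - (q ^+ 2) ^+ (N + l.+1)) =
  theta_wt (N - l) * q ^+ (l.*2.+1) * (1 - (q ^+ 2) ^+ (N - l)).
Proof.
move=> lN; rewrite /theta_wt.
have := @b_ratio (N - l.+1) ltac:(lia).
rewrite (_ : (N - l.+1).+1 = (N - l)%N); last by lia.
rewrite (_ : (N.*2 - (N - l.+1) = N + l.+1)%N); last by lia.
(* Below the centre the rescaled factor is [q^-(2 l + 1)], so reading the ratio backwards gives the
   mirror image of [theta_wt_up]. *)
have H : X * (q ^+ 2) ^+ (N - l.+1) * q ^+ l.*2.+1 = 1.
  rewrite -exprM -mulrA -exprD (_ : (2 * _ + _ = N.*2.-1)%N); last by lia.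
  by rewrite /X -exprMn mulVf ?gt_eqF // expr1n.
set c := X * _ in H * => E.
transitivity (b (N - l.+1) * (c * q ^+ l.*2.+1) * (1 - (q ^+ 2) ^+ (N + l.+1)) / b N).
  by rewrite H mulr1; ring.
transitivity ((b (N - l.+1) * c * (1 - (q ^+ 2) ^+ (N + l.+1))) * q ^+ l.*2.+1 / b N).
  by ring.
by rewrite -E; ring.
Qed.

Lemma theta_wt_le k : (k <= N.*2)%N -> theta_wt k <= q ^+ (absz (k%:Z - N%:Z) ^ 2).
Proof.
move=> kN; rewrite -[leRHS]mul1r -{1}wtN.
have [Nk|kN'] := leqP N k.
  have -> : absz (k%:Z - N%:Z) = (k - N)%N by lia.
  have /= := @quasi_gauss_le _ q N (fun l => theta_wt (N + l)) q01 _ theta_wt_up (k - N).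
  rewrite addn0 subnKC //; apply; last lia.
  by move=> l lN; apply: theta_wt_gt0; lia.
have -> : absz (k%:Z - N%:Z) = (N - k)%N by lia.
have /= := @quasi_gauss_le _ q N (fun l => theta_wt (N - l)) q01 _ theta_wt_down (N - k).
rewrite subn0 subKn; last lia; apply; last lia.
by move=> l lN; apply: theta_wt_gt0; lia.
Qed.

Lemma theta_wt_ge m k : (m <= N)%N -> (absz (k%:Z - N%:Z) <= m)%N ->
  q ^+ (absz (k%:Z - N%:Z) ^ 2) * (1 - (q ^+ 2) ^+ (N - m)) ^+ m <= theta_wt k.
Proof.
move=> mN km; set l := absz _ in km *.
have p1 : (q ^+ 2) ^+ (N - m) <= 1.
  by rewrite !exprn_ile1 ?exprn_ge0 ?(ltW q0) ?(ltW q1).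
have p0 : 0 <= (q ^+ 2) ^+ (N - m) by rewrite !exprn_ge0 ?(ltW q0).
apply: (@le_trans _ _ (theta_wt N * q ^+ (l ^ 2) * (1 - (q ^+ 2) ^+ (N - m)) ^+ l)).
  rewrite wtN mul1r ler_wpM2l ?exprn_ge0 ?(ltW q0) // ler_wiXn2l //; lra.
have [Nk|kN'] := leqP N k.
  have /= := @quasi_gauss_ge _ q N m (fun l => theta_wt (N + l)) q01 mN _ theta_wt_up l.
  rewrite addn0 (_ : (N + l)%N = k); last by lia.
  by apply=> // ? ?; apply: theta_wt_gt0; lia.
have /= := @quasi_gauss_ge _ q N m (fun l => theta_wt (N - l)) q01 mN _ theta_wt_down l.
rewrite subn0 (_ : (N - l)%N = k); last by lia.
by apply=> // ? ?; apply: theta_wt_gt0; lia.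
Qed.

(** The sum factors into terms [1 + z r_j]. Those with [j < N] get the triangle inequality only;
    those with [j >= N] have [r_j = q^(2 (j - N) + 1) <= 1] and each contributes the decay of
    [normc_1Dscale_exp]. *)
Lemma theta_wt_char (z : R[i]) : normc z = 1 ->
  normc (\sum_(k < N.*2.+1) ((theta_wt k)%:C)%C * z ^+ k) <=
  (\sum_(k < N.*2.+1) theta_wt k) *
    expR (- ((\sum_(i < N) q ^+ i.*2.+1) / 4 * (1 - complex.Re z))).
Proof.
move=> z1.
have EC : \sum_(k < N.*2.+1) ((theta_wt k)%:C)%C * z ^+ k =
    ((b N)^-1%:C)%C * \prod_(j < N.*2) (1 + z * ((X * (q ^+ 2) ^+ j)%:C)%C).
  under [in RHS]eq_bigr do rewrite rmorphM mulrA.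
  rewrite -(qbin_prod (real_complex R)) mulr_sumr; apply: eq_bigr => k _.
  by rewrite exprMn -rmorphXn /theta_wt /b !rmorphM; ring.
have ER : \sum_(k < N.*2.+1) theta_wt k =
    (b N)^-1 * \prod_(j < N.*2) (1 + X * (q ^+ 2) ^+ j).
  rewrite -(qbin_prod idfun) mulr_sumr; apply: eq_bigr => k _.
  by rewrite /theta_wt /b mulrC.
have bN0 : 0 < b N by rewrite b0 // -addnn leq_addr.
rewrite EC ER Normc.normcM normc_real gtr0_norm ?invr_gt0 // -[leRHS]mulrA ler_pM2l ?invr_gt0 //.
rewrite normc_prod.
pose e j : R := if (j < N)%N then 0 else q ^+ (j - N).*2.+1 / 4.
have -> : (\sum_(i < N) q ^+ i.*2.+1) / 4 * (1 - complex.Re z) =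
    \sum_(j < N.*2) e j * (1 - complex.Re z).
  rewrite -mulr_suml; congr (_ * _); rewrite mulr_suml -addnn big_split_ord /=.
  rewrite [X in _ = X + _]big1 ?add0r => [|i _]; last by rewrite /e ltn_ord.
  by apply: eq_bigr => i _; rewrite /e ltnNge leq_addr /= addKn.
rewrite -sumrN expR_sum -big_split /=.
apply: ler_prod => j _; rewrite normc_ge0 /=.
have r0 : 0 < X * (q ^+ 2) ^+ j by rewrite mulr_gt0 // !exprn_gt0.
rewrite /e; case: ltnP => jN.
  by rewrite mul0r oppr0 expR0 mulr1; exact: normc_1Dscale.
rewrite -(@theta_shift j (j - N)); last by lia.
apply: normc_1Dscale_exp => //; rewrite r0 /= (@theta_shift j (j - N)); last by lia.
by rewrite exprn_ile1 // ltW.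
Qed.

End ThetaWeights.

(** * Euclidean geometry and Gram-Schmidt residuals *)

Section Euclid.
Context {R : realType} {n : nat}.
Implicit Types (u v w D : 'rV[R]_n) (us : seq 'rV[R]_n).

Lemma dotvC u v : dotv u v = dotv v u.
Proof. by apply: eq_bigr => j _; rewrite mulrC. Qed.

Lemma dotvDl u v w : dotv (u + v) w = dotv u w + dotv v w.
Proof. by rewrite /dotv -big_split; apply: eq_bigr => j _; rewrite mxE mulrDl. Qed.

Lemma dotvZl (c : R) u w : dotv (c *: u) w = c * dotv u w.
Proof. by rewrite /dotv mulr_sumr; apply: eq_bigr => j _; rewrite mxE mulrA. Qed.

Lemma dotvBl u v w : dotv (u - v) w = dotv u w - dotv v w.
Proof. by rewrite dotvDl -scaleN1r dotvZl mulN1r. Qed.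

Lemma dotvBr u v w : dotv w (u - v) = dotv w u - dotv w v.
Proof. by rewrite ![dotv w _]dotvC dotvBl. Qed.

Lemma dotvDr u v w : dotv w (u + v) = dotv w u + dotv w v.
Proof. by rewrite ![dotv w _]dotvC dotvDl. Qed.

Lemma dotvZr (c : R) u w : dotv w (c *: u) = c * dotv w u.
Proof. by rewrite ![dotv w _]dotvC dotvZl. Qed.

Lemma dotv_ge0 v : 0 <= dotv v v.
Proof. by apply: sumr_ge0 => j _; rewrite -expr2 sqr_ge0. Qed.

Lemma norm2_ge0 v : 0 <= norm2 v. Proof. exact: sqrtr_ge0. Qed.

Lemma norm2_sqr v : norm2 v ^+ 2 = dotv v v.
Proof.
rewrite sqr_sqrtr; last by apply: sumr_ge0 => j _; rewrite sqr_ge0.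
by apply: eq_bigr => j _; rewrite expr2.
Qed.

Lemma norm2E v : norm2 v = Num.sqrt (dotv v v).
Proof. by rewrite -norm2_sqr sqrtr_sqr ger0_norm // norm2_ge0. Qed.

Lemma dotv_CS u v : dotv u v <= norm2 u * norm2 v.
Proof.
set a := norm2 u; set b := norm2 v.
have a0 : 0 <= a := norm2_ge0 u; have b0 : 0 <= b := norm2_ge0 v.
have := dotv_ge0 (b *: u - a *: v).
rewrite !(dotvBl, dotvBr, dotvZl, dotvZr) -!norm2_sqr -/a -/b [dotv v u]dotvC => H.
have H' : 0 <= 2 * (a * b) * (a * b - dotv u v) by rewrite (le_trans H) //; lra.
have [ab0|ab0] := eqVneq (a * b) 0; last first.
  have abp : 0 < 2 * (a * b) by rewrite mulr_gt0 // lt_neqAle eq_sym ab0 mulr_ge0.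
  by move: H'; rewrite pmulr_rge0 // subr_ge0.
rewrite ab0.
suff -> : dotv u v = 0 by [].
have zero w : norm2 w = 0 -> w = 0.
  move=> w0; have : dotv w w == 0 by rewrite -norm2_sqr w0 expr0n.
  rewrite psumr_eq0 => [/allP H1|j _]; last by rewrite -expr2 sqr_ge0.
  apply/rowP => j; rewrite mxE; apply/eqP.
  by have := H1 j (mem_index_enum _); rewrite mulf_eq0 orbb.
move/eqP: ab0; rewrite mulf_eq0 => /orP[] /eqP /zero ->.
  by rewrite -(scale0r 0) dotvZl mul0r.
by rewrite -(scale0r 0) dotvZr mul0r.
Qed.

Lemma norm2D u v : norm2 (u + v) <= norm2 u + norm2 v.
Proof.
rewrite -ler_sqr ?qualifE /= ?norm2_ge0 ?addr_ge0 ?norm2_ge0 //.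
rewrite norm2_sqr !(dotvDl, dotvDr) -!norm2_sqr [dotv v u]dotvC.
by have := dotv_CS u v; rewrite sqrrD mulr2n; lra.
Qed.

Lemma norm2Z (c : R) v : norm2 (c *: v) = `|c| * norm2 v.
Proof.
by rewrite !norm2E dotvZl dotvZr mulrA -expr2 sqrtrM ?sqr_ge0 // sqrtr_sqr.
Qed.

Lemma norm2_coord v j : `|v 0 j| <= norm2 v.
Proof.
rewrite -ler_sqr ?qualifE /= ?norm2_ge0 ?normr_ge0 // real_normK ?num_real //.
rewrite norm2_sqr /dotv (bigD1 j) //= -expr2 lerDl.
by apply: sumr_ge0 => i _; rewrite -expr2 sqr_ge0.
Qed.

(** Each projection is subtracted from what the tail has left, so a new vector at the head adds a
    single step, governed by [residual_pythagoras]. When every [u] is the normalised residual of a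
    new vector, this is Gram-Schmidt. *)
Fixpoint residual us D : 'rV[R]_n :=
  if us is u :: us' then residual us' D - dotv (residual us' D) u *: u else D.

Lemma residualD us D E : residual us (D + E) = residual us D + residual us E.
Proof.
elim: us => //= u us ->; rewrite dotvDl scalerDl opprD.
by rewrite addrACA.
Qed.

Lemma residualZ us (c : R) D : residual us (c *: D) = c *: residual us D.
Proof. by elim: us => //= u us ->; rewrite dotvZl scalerBr scalerA. Qed.

Lemma residual_pythagoras us u D : dotv u u = 1 ->
  dotv (residual us D) (residual us D) =
  dotv (residual (u :: us) D) (residual (u :: us) D) + dotv (residual us D) u ^+ 2.
Proof.
move=> u1 /=; set r := residual us D.
rewrite !(dotvBl, dotvBr, dotvZl, dotvZr) u1 [dotv u r]dotvC; ring.
Qed.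

End Euclid.

(** * Characters and the characteristic function of the box measure *)

Section Characters.
Context {R : realType}.
Local Notation normc := (@Normc.normc R).

Lemma expiD (s t : R) : expi (s + t) = expi s * expi t.
Proof. by rewrite /expi cosD sinD; apply/eqP; rewrite eq_complex /= [sin s * _ + _]addrC !eqxx. Qed.

Lemma expi0 : expi (0 : R) = 1.
Proof. by rewrite /expi cos0 sin0. Qed.

Lemma normc_expi (t : R) : normc (expi t) = 1.
Proof. by rewrite /= cos2Dsin2 sqrtr1. Qed.

Lemma expi_natM (k : nat) (t : R) : expi (k%:R * t) = expi t ^+ k.
Proof.
elim: k => [|k IH]; first by rewrite mul0r expi0.
by rewrite -natr1 mulrDl mul1r expiD IH exprSr.
Qed.

Lemma expiN (t : R) : expi (- t) = ((expi t)^*)%C.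
Proof. by rewrite /expi cosN sinN. Qed.

Lemma expi_sum (I : Type) (s : seq I) (F : I -> R) :
  expi (\sum_(i <- s) F i) = \prod_(i <- s) expi (F i).
Proof.
by elim: s => [|i s IH]; rewrite ?big_nil ?expi0 // !big_cons expiD IH.
Qed.

Context {n : nat}.
Implicit Types (D E : 'rV[R]_n) (x : 'rV[int]_n).

Definition chi D x : R[i] := expi (- (2 * pi * dotv D (intvec x))).

Lemma chiD D E x : chi (D + E) x = chi D x * chi E x.
Proof. by rewrite /chi dotvDl mulrDr opprD expiD. Qed.

Lemma normc_chi D x : normc (chi D x) = 1.
Proof. exact: normc_expi. Qed.

Lemma chi_natZ (k : nat) D x : chi (k%:R *: D) x = chi D x ^+ k.
Proof. by rewrite /chi dotvZl -expi_natM; congr expi; ring. Qed.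

Lemma chiN D x : chi (- D) x = ((chi D x)^*)%C.
Proof. by rewrite /chi -expiN -[- D]scaleN1r dotvZl; congr expi; ring. Qed.

Lemma chi_natBZ (a b : nat) D x :
  chi ((a%:R - b%:R) *: D) x = chi D x ^+ a * ((chi D x)^*)%C ^+ b.
Proof. by rewrite scalerBl chiD chi_natZ -scalerN chi_natZ chiN. Qed.

Section Box.
Variables (q : R) (N : nat).
Hypotheses (q01 : 0 < q < 1) (N0 : (0 < N)%N).

Definition box_pt (f : {ffun 'I_n -> 'I_N.*2.+1}) : 'rV[int]_n :=
  \row_j ((f j)%:Z - N%:Z).

Definition box_wt (f : {ffun 'I_n -> 'I_N.*2.+1}) : R := \prod_j theta_wt q N (f j).

Lemma box_wt_ge0 f : 0 <= box_wt f.
Proof. by apply: prodr_ge0 => j _; rewrite ltW // theta_wt_gt0 // -ltnS. Qed.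

(** The sum is a product over coordinates; each factor is the sum of [theta_wt_char] up to a
    unimodular phase, which comes from recentring [k] at [N]. *)
Lemma box_char D :
  normc (\sum_f ((box_wt f)%:C)%C * chi D (box_pt f)) <=
  (\sum_f box_wt f) *
    expR (- ((\sum_(i < N) q ^+ i.*2.+1) / 4 * \sum_j (1 - cos (2 * pi * D 0 j)))).
Proof.
pose G (j : 'I_n) (k : 'I_N.*2.+1) :=
  ((theta_wt q N k)%:C)%C * expi (- (2 * pi * D 0 j * (k%:R - N%:R))).
have -> : \sum_f ((box_wt f)%:C)%C * chi D (box_pt f) = \prod_j \sum_k G j k.
  rewrite bigA_distr_bigA; apply: eq_bigr => f _.
  rewrite /G big_split /= -rmorph_prod; congr (_ * _).
  rewrite -expi_sum; congr expi; rewrite /dotv mulr_sumr -sumrN.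
  apply: eq_bigr => j _; rewrite !mxE /= intrB -!pmulrn; ring.
have -> : \sum_f box_wt f = \prod_(j < n) \sum_(k < N.*2.+1) theta_wt q N k.
  by rewrite bigA_distr_bigA.
rewrite normc_prod mulr_sumr -sumrN expR_sum -big_split /=.
apply: ler_prod => j _; rewrite normc_ge0 /=.
have /= := theta_wt_char q01 N0 (normc_expi (- (2 * pi * D 0 j))).
rewrite cosN; apply: le_trans.
have := normc_expi (2 * pi * D 0 j * N%:R); set e := expi _ => e1.
rewrite -[leRHS]mul1r -[X in _ <= X * _]e1 -Normc.normcM mulr_sumr /e.
rewrite le_eqVlt; apply/orP; left; apply/eqP; congr normc.
apply: eq_bigr => k _; rewrite /G mulrCA; congr (_ * _).
by rewrite -expi_natM -expiD; congr expi; ring.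
Qed.

End Box.
End Characters.

(** * Separated families and products of Fejer kernels *)

Section Separated.
Context {R : realType} {n : nat}.
Local Notation normc := (@Normc.normc R).
Implicit Types (D z u : 'rV[R]_n) (l : seq ('rV[R]_n * 'rV[R]_n)).

(** The newest pair is at the head. The vanishing residual makes [u] the unit vector along the
    residual of [z], whose length is then the product bounded below by [rho]. Carrying [u] along
    records the Gram-Schmidt basis. *)
Fixpoint separated (X : set 'rV[R]_n) (rho : R) l : Prop :=
  if l is (z, u) :: l' then
    [/\ X z, dotv u u = 1, rho <= dotv (residual (unzip2 l') z) u,
        residual (u :: unzip2 l') z = 0 & separated X rho l']
  else True.

Lemma greedy_separated (X : set 'rV[R]_n) (rho : R) (M : nat) : 0 < rho ->
  (exists2 l, size l = M & separated X rho l) \/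
  (exists l, [/\ (size l < M)%N, separated X rho l &
     forall z, X z -> norm2 (residual (unzip2 l) z) <= rho]).
Proof.
move=> rho0; elim: M => [|M [[l lM sl]|[l [lM sl cl]]]]; first by left; exists [::].
  have [cl|/existsNP[z /not_implyP[Xz /negP]]] :=
      pselect (forall z, X z -> norm2 (residual (unzip2 l) z) <= rho).
    by right; exists l; rewrite lM.
  rewrite -ltNge => rz; left; set r := residual _ z in rz.
  have r0 : 0 < norm2 r by apply: lt_trans rz.
  have d : dotv r r = norm2 r ^+ 2 by rewrite norm2_sqr.
  exists ((z, (norm2 r)^-1 *: r) :: l); first by rewrite /= lM.
  split=> //; rewrite -/r ?dotvZl ?dotvZr ?d.
  - by field; apply/eqP; lra.
  - by rewrite expr2 mulKf ?gt_eqF // ltW.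
  - rewrite /= -/r dotvZr d scalerA expr2 mulKf ?gt_eqF // divff ?gt_eqF //.
    by rewrite scale1r subrr.
by right; exists l; split=> //; exact: ltnW.
Qed.

Variables (om : 'rV[R]_n -> R[i]) (L : nat).
Hypotheses (om1 : forall z, normc (om z) = 1) (L0 : (0 < L)%N).

Definition fejer z (x : 'rV[int]_n) : R :=
  normc (\sum_(a < L) (om z * chi z x) ^+ a) ^+ 2 / L%:R ^+ 2.

Let w1 z x : normc (om z * chi z x) = 1.
Proof. by rewrite Normc.normcM om1 normc_chi mulr1. Qed.

Lemma fejer01 z x : 0 <= fejer z x <= 1.
Proof.
have L2 : 0 < L%:R ^+ 2 :> R by rewrite exprn_gt0 // ltr0n.
rewrite /fejer divr_ge0 ?sqr_ge0 //= ler_pdivrMr // mul1r.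
rewrite ler_sqr ?qualifE /= ?normc_ge0 //; apply: le_trans (ler_normc_sum _ _) _.
under eq_bigr do rewrite normcX w1 expr1n.
by rewrite sumr_const card_ord.
Qed.

Lemma normc_conjM (y : R[i]) : ((normc y ^+ 2)%:C)%C = y * (y^*)%C.
Proof. by rewrite normc2E add_Re2_Im2 sqr_normc. Qed.

Let conjcM (y z : R[i]) : ((y * z)^*)%C = (y^*)%C * (z^*)%C.
Proof. exact: (rmorphM (@conjc R)). Qed.

Let conjcX (y : R[i]) k : ((y ^+ k)^*)%C = (y^*)%C ^+ k.
Proof. exact: (rmorphXn (@conjc R)). Qed.

Lemma fejerE z x : ((fejer z x)%:C)%C =
  \sum_(a < L) \sum_(b < L) ((L%:R ^- 2)%:C)%C * (om z ^+ a * ((om z)^*)%C ^+ b) *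
    chi ((a%:R - b%:R) *: z) x.
Proof.
transitivity (((normc (\sum_(a < L) (om z * chi z x) ^+ a) ^+ 2)%:C)%C * ((L%:R ^- 2)%:C)%C).
  by rewrite -rmorphM.
rewrite normc_conjM rmorph_sum /= big_distrl /= mulr_suml.
apply: eq_bigr => a _; rewrite big_distrr /= mulr_suml; apply: eq_bigr => b _.
by rewrite chi_natBZ conjcX conjcM !exprMn; ring.
Qed.

(** On the unit circle [1 - Re w = |1 - w|^2 / 2], and [|1 - w^k| <= k |1 - w|] by the geometric
    sum. *)
Lemma one_sub_ReX (w : R[i]) (k : nat) : normc w = 1 ->
  1 - complex.Re (w ^+ k) <= k%:R ^+ 2 * (1 - complex.Re w).
Proof.
move=> w1'.
have E (v : R[i]) : normc v = 1 -> 1 - complex.Re v = normc (1 - v) ^+ 2 / 2.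
  move=> v1; have := normc2E v; rewrite v1 expr1n => v2.
  rewrite normc2E; case: v {v1} v2 => a b /= ab.
  lra.
rewrite !E ?normcX ?w1' ?expr1n // mulrA ler_pM2r ?invr_gt0 // -exprMn.
rewrite ler_sqr ?qualifE /= ?normc_ge0 ?mulr_ge0 ?normc_ge0 //.
rewrite -{1}(expr1n _ k) subrXX Normc.normcM mulrC ler_wpM2r ?normc_ge0 //.
apply: le_trans (ler_normc_sum _ _) _.
under eq_bigr do rewrite expr1n mul1r normcX w1' expr1n.
by rewrite sumr_const card_ord.
Qed.

(** The square expands into the terms [Re w^|a - b|] with [|a - b| <= L], and [one_sub_ReX] bounds
    each of them from below. *)
Lemma one_sub_fejer_le z x :
  1 - fejer z x <= L%:R ^+ 2 * (1 - complex.Re (om z * chi z x)).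
Proof.
set w := om z * chi z x; have w1' : normc w = 1 := w1 z x.
have Ln0 : L%:R != 0 :> R by rewrite pnatr_eq0 -lt0n.
have ww : w * (w^*)%C = 1 by rewrite -normc_conjM w1' expr1n.
have Re_le1 : complex.Re w <= 1.
  have := normc2E w; rewrite w1' expr1n; have := sqr_ge0 (complex.Im w); nra.
have bound (a b : 'I_L) :
    1 - L%:R ^+ 2 * (1 - complex.Re w) <= complex.Re (w ^+ a * (w^*)%C ^+ b).
  have mono (k : nat) : (k <= L)%N ->
      1 - L%:R ^+ 2 * (1 - complex.Re w) <= complex.Re (w ^+ k).
    move=> kL; have := one_sub_ReX k w1'.
    have : k%:R ^+ 2 * (1 - complex.Re w) <= L%:R ^+ 2 * (1 - complex.Re w).
      rewrite ler_wpM2r ?subr_ge0 // ler_sqr ?qualifE /= ?ler_nat //.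
    lra.
  have cut (a' b' : nat) : (b' <= a')%N -> w ^+ a' * (w^*)%C ^+ b' = w ^+ (a' - b').
    by move=> ba; rewrite -{1}(subnK ba) exprD -mulrA -exprMn ww expr1n mulr1.
  have [ba|ab] := leqP b a.
    by rewrite cut //; apply: mono; rewrite (leq_trans (leq_subr _ _)) // ltnW.
  have -> : complex.Re (w ^+ a * (w^*)%C ^+ b) = complex.Re (w ^+ (b - a)).
    rewrite -(cut b a (ltnW ab)).
    have -> : w ^+ a * (w^*)%C ^+ b = ((w ^+ b * (w^*)%C ^+ a)^*)%C.
      by rewrite conjcM !conjcX conjcK mulrC.
    by case: (_ * _).
  by apply: mono; rewrite (leq_trans (leq_subr _ _)) // ltnW.
have E : normc (\sum_(a < L) w ^+ a) ^+ 2 =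
    \sum_(a < L) \sum_(b < L) complex.Re (w ^+ a * (w^*)%C ^+ b).
  have -> : normc (\sum_(a < L) w ^+ a) ^+ 2 =
      complex.Re ((normc (\sum_(a < L) w ^+ a) ^+ 2)%:C)%C by [].
  rewrite normc_conjM rmorph_sum /= big_distrl /=.
  rewrite (raddf_sum (@complex.Re R : {additive Rcomplex R -> R})).
  apply: eq_bigr => a _; rewrite big_distrr /=.
  rewrite (raddf_sum (@complex.Re R : {additive Rcomplex R -> R})).
  by apply: eq_bigr => b _; rewrite conjcX.
rewrite /fejer -/w E.
suff : 1 - L%:R ^+ 2 * (1 - complex.Re w) <=
   (\sum_(a < L) \sum_(b < L) complex.Re (w ^+ a * (w^*)%C ^+ b)) / L%:R ^+ 2 by lra.
rewrite ler_pdivlMr ?exprn_gt0 ?ltr0n //.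
apply: (@le_trans _ _ (\sum_(a < L) \sum_(b < L) (1 - L%:R ^+ 2 * (1 - complex.Re w)))).
  by rewrite !sumr_const !card_ord -mulrnA -[leRHS]mulr_natr natrM expr2.
by apply: ler_sum => a _; apply: ler_sum => b _; exact: bound.
Qed.

Variables (I : finType) (wt : I -> R) (v : I -> 'rV[int]_n) (Z a rho kap : R).
Hypotheses (Z0 : 0 <= Z) (a0 : 0 < a) (rho0 : 0 < rho).
Hypothesis char_le : forall D, norm2 D <= 1 / 2 ->
  normc (\sum_i ((wt i)%:C)%C * chi D (v i)) <= Z * expR (- (a * dotv D D)).

(* Expanding the Fejer factor of the last [z] shifts [D] by the multiples
   [(c - b) z], which move the residual only along [u]; there the Gaussian
   bound sums up to [2 + 4 / (sqrt a * rho)] over the [L] values of [c]. *)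
Lemma fejer_prod_le l D :
  separated [set z | norm2 z <= kap] rho l ->
  norm2 D + (size l)%:R * (L%:R * kap) <= 1 / 2 ->
  normc (\sum_i ((wt i)%:C)%C * ((\prod_(e <- l) fejer e.1 (v i))%:C)%C * chi D (v i))
  <= Z * ((2 + 4 / (Num.sqrt a * rho)) / L%:R) ^+ size l *
     expR (- (a * dotv (residual (unzip2 l) D) (residual (unzip2 l) D))).
Proof.
set s := 2 + 4 / (Num.sqrt a * rho).
have sa0 : 0 < Num.sqrt a by rewrite sqrtr_gt0.
have s0 : 0 <= s by rewrite addr_ge0 // divr_ge0 // mulr_ge0 // ltW.
have Lp : 0 < L%:R :> R by rewrite ltr0n.
elim: l D => [|[z u] l IH] D.
  move=> _; rewrite mul0r addr0 => D2; rewrite expr0 mulr1.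
  by under eq_bigr do rewrite big_nil mulr1; exact: char_le.
move=> [Xz u1 rz rz0 sl] DL.
have zk : norm2 z <= kap := Xz.
have kap0 : 0 <= kap by apply: le_trans zk; exact: norm2_ge0.
pose T D' := \sum_i ((wt i)%:C)%C * ((\prod_(e <- l) fejer e.1 (v i))%:C)%C * chi D' (v i).
pose cf (c b : 'I_L) := ((L%:R ^- 2)%:C)%C * (om z ^+ c * ((om z)^*)%C ^+ b) : R[i].
have -> : \sum_i ((wt i)%:C)%C * ((\prod_(e <- (z, u) :: l) fejer e.1 (v i))%:C)%C
      * chi D (v i) = \sum_c \sum_b cf c b * T (D + (c%:R - b%:R) *: z).
  transitivity (\sum_i \sum_c \sum_b cf c b * (((wt i)%:C)%C *
    ((\prod_(e <- l) fejer e.1 (v i))%:C)%C * chi (D + (c%:R - b%:R) *: z) (v i))).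
    apply: eq_bigr => i _; rewrite big_cons rmorphM /= fejerE.
    have AC (y1 y2 y3 y4 : R[i]) : y1 * (y2 * y3) * y4 = y2 * (y1 * y3 * y4) by ring.
    rewrite AC mulr_suml; apply: eq_bigr => c _.
    rewrite mulr_suml; apply: eq_bigr => b _.
    by rewrite chiD /cf; ring.
  rewrite exchange_big; apply: eq_bigr => c _ /=.
  by rewrite exchange_big; apply: eq_bigr => b _ /=; rewrite mulr_sumr.
have ncf c b : normc (cf c b) = L%:R ^- 2.
  rewrite /cf !Normc.normcM normc_real !normcX om1 expr1n mul1r.
  have -> : normc ((om z)^*)%C = 1.
    by rewrite -(om1 z); case: (om z) => ? ? /=; rewrite sqrrN.
  by rewrite expr1n mulr1 ger0_norm // invr_ge0 sqr_ge0.
set t := dotv (residual (unzip2 l) D) u; set d := dotv (residual (unzip2 l) z) u in rz.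
set F := Z * (s / L%:R) ^+ size l; set G := dotv (residual (unzip2 ((z, u) :: l)) D) _.
have F0 : 0 <= F by rewrite mulr_ge0 // exprn_ge0 // divr_ge0 // ltW.
have TB (c b : 'I_L) : normc (T (D + (c%:R - b%:R) *: z)) <=
    F * expR (- (a * G)) * expR (- (a * (t - b%:R * d + c%:R * d) ^+ 2)).
  have H := IH (D + (c%:R - b%:R) *: z) sl _.
  apply: le_trans (H _) _; last first.
    rewrite (residual_pythagoras _ _ u1) !residualD !residualZ rz0 scaler0 addr0.
    rewrite -[leRHS]mulrA -expRD -/F dotvDl dotvZl -/t -/d.
    rewrite -[residual (u :: _) D]/(residual (unzip2 ((z, u) :: l)) D) -/G.
    rewrite le_eqVlt; apply/orP; left; apply/eqP; congr (_ * expR _); ring.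
  (* The shift has norm at most [L kap], which is exactly the share of the norm budget freed by
     removing one pair. *)
  apply: le_trans DL; rewrite [size _]/= -natr1 mulrDl mul1r [in leRHS]addrA addrAC lerD2r.
  apply: le_trans (norm2D _ _) _; rewrite lerD2l norm2Z.
  apply: ler_pM => //; rewrite ?norm2_ge0 // ler_norml.
  have := ler0n R c; have := ler0n R b.
  have : c%:R <= L%:R :> R by rewrite ler_nat ltnW.
  have : b%:R <= L%:R :> R by rewrite ler_nat ltnW.
  by lra.
apply: le_trans (ler_normc_sum _ _) _.
apply: (@le_trans _ _ (\sum_(c < L) \sum_(b < L) L%:R ^- 2 * (F * expR (- (a * G)) *
    expR (- (a * (t - b%:R * d + c%:R * d) ^+ 2))))).
  apply: ler_sum => c _; apply: le_trans (ler_normc_sum _ _) _.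
  apply: ler_sum => b _; rewrite Normc.normcM ncf ler_wpM2l // invr_ge0 sqr_ge0 //.
rewrite exchange_big /=.
under eq_bigr do rewrite -mulr_sumr -mulr_sumr.
have d0 : 0 < d by apply: lt_le_trans rz.
apply: (@le_trans _ _ (\sum_(b < L) L%:R ^- 2 * (F * expR (- (a * G)) * s))).
  apply: ler_sum => b _; rewrite ler_wpM2l ?invr_ge0 ?sqr_ge0 //.
  apply: ler_wpM2l (mulr_ge0 F0 (expR_ge0 _)) _ _ _.
  apply: le_trans (sum_lattice_gauss_le (t - b%:R * d) L a0 d0) _.
  rewrite lerD2l ler_pM2l // lef_pV2 ?qualifE /= ?mulr_gt0 // ler_pM2l //.
rewrite sumr_const card_ord -[X in X <= _]mulr_natr [size _]/= (exprSr (s / _)).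
rewrite le_eqVlt; apply/orP; left; apply/eqP; rewrite /F.
move: ((s / L%:R) ^+ size l) (expR _) => y e.
by field; rewrite gt_eqF.
Qed.

End Separated.

(** * Truncation of infinite sums to finite sets *)

Section FiniteApproximation.
Context {R : realType} {T : choiceType}.
Implicit Types (f g mu : T -> R) (s : seq T).

Lemma esum_ge_seq g s : uniq s ->
  ((\sum_(x <- s) g x)%:E <= \esum_(x in [set: T]) (g x)%:E)%E.
Proof.
move=> us; apply: esum_ge; exists [set` s]; first by split => //; exact: finite_seq.
by rewrite -fsbig_seq // sumEFin.
Qed.

Lemma esum_le_seq g (M : R) : (forall s, uniq s -> \sum_(x <- s) g x <= M) ->
  (\esum_(x in [set: T]) (g x)%:E <= M%:E)%E.
Proof.
move=> H; apply: ge_ereal_sup => _ [X [finX _] <-].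
by rewrite fsbig_finite //= sumEFin lee_fin; apply: H; exact: finmap.fset_uniq.
Qed.

(** Outside [s] the sum of [g] is at most the mass of [mu] that [s] misses. *)
Lemma fine_esum_approx g mu s : (forall x, 0 <= g x <= mu x) ->
  (\esum_(x in [set: T]) (mu x)%:E = 1%:E)%E -> uniq s ->
  \sum_(x <- s) g x <= fine (\esum_(x in [set: T]) (g x)%:E)
    <= \sum_(x <- s) g x + (1 - \sum_(x <- s) mu x).
Proof.
move=> gmu mu1 us; set e := esum _ _.
have lo : ((\sum_(x <- s) g x)%:E <= e)%E by exact: esum_ge_seq.
have hi : (e <= (\sum_(x <- s) g x + (1 - \sum_(x <- s) mu x))%:E)%E.
  apply: esum_le_seq => t ut.
  have : \sum_(x <- s ++ [seq x <- t | x \notin s]) mu x <= 1.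
    rewrite -lee_fin -mu1; apply: esum_ge_seq.
    rewrite cat_uniq us filter_uniq // andbT.
    by apply/hasPn => x; rewrite mem_filter => /andP[].
  rewrite big_cat /= big_filter => tail.
  have -> : \sum_(x <- t) g x = \sum_(x <- t | x \in s) g x + \sum_(x <- t | x \notin s) g x.
    by rewrite (bigID (fun x => x \in s)).
  have h1 : \sum_(x <- t | x \notin s) g x <= \sum_(x <- t | x \notin s) mu x.
    by apply: ler_sum => x _; case/andP: (gmu x).
  have h2 : \sum_(x <- t | x \in s) g x <= \sum_(x <- s) g x.
    have -> : \sum_(x <- t | x \in s) g x = \sum_(x <- s | x \in t) g x.
      rewrite -!(big_filter _ (fun x => x \in _)).
      apply: perm_big; apply: uniq_perm; rewrite ?filter_uniq // => x.
      by rewrite !mem_filter andbC.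
    rewrite [leRHS](bigID (fun x => x \in t)) /= lerDl.
    by apply: sumr_ge0 => x _; case/andP: (gmu x).
  by move: tail h1 h2; lra.
have efin : e \is a fin_num.
  by rewrite fin_numE; apply/andP; split; apply/eqP => ee; move: lo hi; rewrite ee.
by move: lo hi; rewrite -{1 2}(fineK efin) !lee_fin => -> ->.
Qed.

(** The truncation errors of the positive and negative parts both lie between 0 and the missing
    mass, so their difference costs that mass only once. *)
Lemma rsum_approx f mu s : (forall x, `|f x| <= mu x) ->
  (\esum_(x in [set: T]) (mu x)%:E = 1%:E)%E -> uniq s ->
  `|rsum f - \sum_(x <- s) f x| <= 1 - \sum_(x <- s) mu x.
Proof.
move=> fmu mu1 us.
have P x : f^\+%R x + f^\-%R x = `|f x| by have := congr1 (fun h => h x) (funrposDneg f).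
have M x : f^\+%R x - f^\-%R x = f x by have := congr1 (fun h => h x) (funrposBneg f).
have p0 := funrpos_ge0 f; have n0 := funrneg_ge0 f.
have hp x : 0 <= f^\+%R x <= mu x.
  by rewrite p0 /= (le_trans _ (fmu x)) // -P lerDl.
have hn x : 0 <= f^\-%R x <= mu x.
  by rewrite n0 /= (le_trans _ (fmu x)) // -P lerDr.
have /andP[a1 a2] := fine_esum_approx hp mu1 us.
have /andP[b1 b2] := fine_esum_approx hn mu1 us.
have -> : \sum_(x <- s) f x = \sum_(x <- s) f^\+%R x - \sum_(x <- s) f^\-%R x.
  by rewrite -sumrB; apply: eq_bigr => x _; rewrite M.
rewrite /rsum ler_norml; apply/andP; split; lra.
Qed.

Lemma mass_approx mu (eps : R) : 0 < eps ->
  (\esum_(x in [set: T]) (mu x)%:E = 1%:E)%E ->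
  exists2 s, uniq s & 1 - eps <= \sum_(x <- s) mu x.
Proof.
move=> e0 mu1; apply: contrapT => H.
suff : (\esum_(x in [set: T]) (mu x)%:E <= (1 - eps)%:E)%E.
  by rewrite mu1 lee_fin; lra.
apply: esum_le_seq => s us; rewrite leNgt; apply/negP => H1; apply: H.
by exists s => //; exact: ltW.
Qed.

End FiniteApproximation.

(** * Phases of Fourier coefficients in the large spectrum *)

Section Spectrum.
Context {R : realType} {n : nat}.
Local Notation normc := (@Normc.normc R).

(** The value 1 at 0 keeps the phase unimodular everywhere, as the Fejer estimates require of
    [om]. *)
Definition phase (y : R[i]) : R[i] := if y == 0 then 1 else (y^*)%C * ((normc y)^-1%:C)%C.

Lemma normc_phase y : normc (phase y) = 1.
Proof.
rewrite /phase; case: eqP => [_|/eqP y0]; first exact: Normc.normc1.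
have ny : normc y != 0 by apply: contra_neq y0; exact: Normc.eq0_normc.
rewrite Normc.normcM normc_real normfV ger0_norm ?normc_ge0 //.
have -> : normc (y^*)%C = normc y by case: y {y0 ny} => a b /=; rewrite sqrrN.
by rewrite divff.
Qed.

Lemma phaseM y : phase y * y = ((normc y)%:C)%C.
Proof.
rewrite /phase; case: eqP => [->|/eqP y0]; first by rewrite mulr0 Normc.normc0.
have ny : normc y != 0 by apply: contra_neq y0; exact: Normc.eq0_normc.
rewrite mulrAC [_ * y]mulrC -normc_conjM -rmorphM; congr ((_)%:C)%C.
by rewrite expr2 mulfK.
Qed.

(** Rotated by its phase, the Fourier coefficient is real and at least [1 - 1/K]. Truncating its
    real and imaginary sums costs the missing mass once each, whence the factor 2. *)
Lemma spectrum_sum_ge (mu : 'rV[int]_n -> R) (K : R) (z : 'rV[R]_n) (s : seq 'rV[int]_n) :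
  prob_mass mu -> large_spectrum K mu z -> uniq s ->
  1 - 1 / K - 2 * (1 - \sum_(x <- s) mu x) <=
  \sum_(x <- s) mu x * complex.Re (phase (fourier mu z) * chi z x).
Proof.
move=> [mu0 mu1] Kz us; set y := fourier mu z in Kz *; set e := 1 - \sum_(x <- s) mu x.
have yK : 1 - 1 / K <= normc y := Kz.
pose fr x := complex.Re (((mu x)%:C)%C * expi (- (2 * pi * dotv z (intvec x)))).
pose fi x := complex.Im (((mu x)%:C)%C * expi (- (2 * pi * dotv z (intvec x)))).
have frE x : fr x = mu x * complex.Re (chi z x) by rewrite /fr /= mul0r subr0.
have fiE x : fi x = mu x * complex.Im (chi z x) by rewrite /fi /= mul0r addr0.
have chi1 x : complex.Re (chi z x) ^+ 2 + complex.Im (chi z x) ^+ 2 = 1.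
  by rewrite -normc2E normc_chi expr1n.
have le1 (a b : R) : a ^+ 2 + b ^+ 2 = 1 -> `|a| <= 1.
  move=> ab; rewrite -ler_sqr ?qualifE /= // real_normK ?num_real // expr1n.
  by have := sqr_ge0 b; lra.
have hr : `|rsum fr - \sum_(x <- s) fr x| <= e.
  apply: rsum_approx => // x; rewrite frE normrM (ger0_norm (mu0 x)).
  by apply: ler_piMr => //; apply: le1 (chi1 x).
have hi : `|rsum fi - \sum_(x <- s) fi x| <= e.
  apply: rsum_approx => // x; rewrite fiE normrM (ger0_norm (mu0 x)).
  by apply: ler_piMr => //; apply: (le1 _ (complex.Re (chi z x))); rewrite addrC.
have yE : y = (rsum fr +i* rsum fi)%C by [].
have py : complex.Re (phase y * y) = normc y by rewrite phaseM.
have := normc_phase y; move: py; move: (phase y) => om py om1.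
have om2 : complex.Re om ^+ 2 + complex.Im om ^+ 2 = 1 by rewrite -normc2E om1 expr1n.
have py' : complex.Re om * rsum fr - complex.Im om * rsum fi = normc y.
  by rewrite -py yE; case: om {py om1 om2} => ? ?.
have -> : \sum_(x <- s) mu x * complex.Re (om * chi z x) =
    complex.Re om * (\sum_(x <- s) fr x) - complex.Im om * (\sum_(x <- s) fi x).
  rewrite !mulr_sumr -sumrB; apply: eq_bigr => x _; rewrite frE fiE.
  by case: om {py om1 om2 py'} => a b; case: (chi z x) => c d /=; ring.
have a1 : `|complex.Re om * (rsum fr - \sum_(x <- s) fr x)| <= e.
  rewrite normrM -[e]mul1r; apply: ler_pM => //; exact: le1 om2.
have b1 : `|complex.Im om * (rsum fi - \sum_(x <- s) fi x)| <= e.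
  rewrite normrM -[e]mul1r; apply: ler_pM => //.
  by apply: (le1 _ (complex.Re om)); rewrite addrC.
move: a1 b1; rewrite (mulrBr _ (rsum fr)) (mulrBr _ (rsum fi)) !ler_norml.
by move=> /andP[_ a2] /andP[b1 _]; lra.
Qed.

End Spectrum.

(** * From the discrete Gaussian to box measures, and the bound on separated families *)

Section DiscreteGaussian.
Context {R : realType} {n : nat}.
Local Notation normc := (@Normc.normc R).
Implicit Types (x : 'rV[int]_n).

Lemma eventually_expr_le (p eps : R) : 0 <= p < 1 -> 0 < eps ->
  exists N0, forall N, (N0 <= N)%N -> p ^+ N <= eps.
Proof.
move=> /andP[p0 p1] e0.
have : (fun N => p ^+ N) @ \oo --> (0 : R) by apply: cvg_expr; rewrite ger0_norm.
move=> /cvgr0_norm_le /(_ _ e0) [N0 _ H]; exists N0 => N NN.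
by have := H N NN; rewrite ger0_norm // exprn_ge0.
Qed.

Lemma bernoulli_le (p : R) (k : nat) : 0 <= p <= 1 -> 1 - k%:R * p <= (1 - p) ^+ k.
Proof.
move=> /andP[p0 p1]; elim: k => [|k IH]; first by rewrite mul0r subr0 expr0.
rewrite exprS -natr1; have p1' : 0 <= 1 - p by lra.
have kp0 : 0 <= k%:R * (p * p) by rewrite !mulr_ge0.
by have := ler_wpM2l p1' IH; lra.
Qed.

Variable r : R.
Hypothesis r0 : 0 < r.
Let q : R := expR (- (pi / r ^+ 2)).

Let q01 : 0 < q < 1.
Proof. by rewrite expR_gt0 expR_lt1 oppr_lt0 divr_gt0 ?pi_gt0 ?exprn_gt0. Qed.

Lemma gauss_weightE x : gauss_weight r x = \prod_j q ^+ (absz (x 0%R j) ^ 2).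
Proof.
rewrite /gauss_weight norm2_sqr /dotv.
have -> : - (pi * (\sum_(j < n) (intvec x : 'rV[R]_n) 0 j * (intvec x : 'rV[R]_n) 0 j) / r ^+ 2) =
    \sum_(j < n) (absz (x 0%R j) ^ 2)%:R * (- (pi / r ^+ 2)).
  rewrite -mulr_suml mulrN [_ * (pi / _)]mulrC; congr (- _).
  rewrite mulrAC; congr (_ * _); apply: eq_bigr => j _; rewrite !mxE.
  have -> : (absz (x 0%R j) ^ 2)%:R = ((x 0 j) ^+ 2)%:~R :> R.
    move: (x 0 j) => k; rewrite (_ : k ^+ 2 = Posz (absz k ^ 2)%N) ?pmulrn //.
    by rewrite expr2 -mulnn; nia.
  by rewrite expr2 intrM.
by rewrite expR_sum; apply: eq_bigr => j _; rewrite expRM_natl.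
Qed.

Section FixedBox.
Variable N : nat.
Local Notation box := {ffun 'I_n -> 'I_N.*2.+1}.

Lemma box_pt_inj : injective (@box_pt n N).
Proof.
move=> f g /rowP fg; apply/ffunP => j; apply: val_inj => /=.
have := fg j; rewrite !mxE => H; lia.
Qed.

Lemma box_pt_onto x : (forall j, (absz (x 0%R j) <= N)%N) -> exists f : box, box_pt f = x.
Proof.
move=> xN; exists [ffun j => inord (absz (x 0%R j + N%:Z))].
apply/rowP => j; rewrite mxE ffunE inordK; have := xN j; lia.
Qed.

Hypothesis N0 : (0 < N)%N.

Lemma box_wt_le (f : box) : box_wt q f <= gauss_weight r (box_pt f).
Proof.
rewrite gauss_weightE; apply: ler_prod => j _; rewrite mxE.
have kN : (f j <= N.*2)%N by rewrite -ltnS.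
by rewrite theta_wt_le // ltW // theta_wt_gt0.
Qed.

Lemma box_wt_ge m (f : box) : (m <= N)%N -> (forall j, (absz (box_pt f 0%R j) <= m)%N) ->
  gauss_weight r (box_pt f) * (1 - (q ^+ 2) ^+ (N - m)) ^+ (m * n) <= box_wt q f.
Proof.
move=> mN fm; rewrite gauss_weightE exprM.
have -> : (1 - (q ^+ 2) ^+ (N - m)) ^+ m ^+ n = \prod_(j < n) (1 - (q ^+ 2) ^+ (N - m)) ^+ m.
  by rewrite prodr_const card_ord.
rewrite -big_split /=; apply: ler_prod => j _.
have /andP[q0 q1] := q01.
rewrite mulr_ge0 ?exprn_ge0 ?(ltW q0) //=; last first.
  by rewrite subr_ge0 -exprM exprn_ile1 // ltW.
by have := fm j; rewrite mxE; exact: theta_wt_ge.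
Qed.

Lemma box_wt_sum_gt0 : 0 < \sum_f box_wt q (f : box).
Proof.
have F0 : 'I_N.*2.+1 by exact: ord0.
rewrite (bigD1 [ffun=> F0]) //= ltr_wpDr //.
  by apply: sumr_ge0 => f _; exact: box_wt_ge0.
by apply: prodr_gt0 => j _; rewrite theta_wt_gt0 // -ltnS.
Qed.

Lemma box_wt_sum_le (M : R) :
  (\esum_(x in [set: 'rV[int]_n]) (gauss_weight r x)%:E = M%:E)%E ->
  \sum_f box_wt q (f : box) <= M.
Proof.
move=> EM; apply: (@le_trans _ _ (\sum_(f : box) gauss_weight r (box_pt f))).
  by apply: ler_sum => f _; exact: box_wt_le.
rewrite -lee_fin -EM.
have := @esum_ge_seq R _ (gauss_weight r) [seq box_pt f | f <- index_enum box].
by rewrite big_map; apply; rewrite (map_inj_uniq box_pt_inj) index_enum_uniq.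
Qed.

End FixedBox.

(** On the finite set [s] the box weights are eventually at least 3/4 of the Gaussian weights, and
    their total never exceeds the Gaussian normaliser. So the normalised box measure dominates 3/4
    of the discrete Gaussian on [s]. *)
Lemma dense_piece_box_le (alpha : R) (mu : 'rV[int]_n -> R) (s : seq 'rV[int]_n) :
  0 < alpha -> prob_mass mu -> dense_piece alpha mu (discrete_gaussian r) -> uniq s ->
  exists N1, forall N, (N1 <= N)%N -> (0 < N)%N ->
  forall G : 'rV[int]_n -> R, (forall x, 0 <= G x) ->
  \sum_(x <- s) mu x * G x <= alpha^-1 * (4 / 3) *
    ((\sum_(f : {ffun 'I_n -> 'I_N.*2.+1}) box_wt q f * G (box_pt f)) /
     \sum_(f : {ffun 'I_n -> 'I_N.*2.+1}) box_wt q f).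
Proof.
move=> alpha0 [mu0 mu1] dp us; set E := (\esum_(x in [set: 'rV[int]_n]) (gauss_weight r x)%:E)%E.
have E0 : (0 <= E)%E by apply: esum_ge0 => x _; rewrite lee_fin expR_ge0.
(* If the normalising sum were infinite, [fine] would make it [0], and [mu] with it. *)
have Efin : E \is a fin_num.
  rewrite ge0_fin_numE // ltNge leye_eq; apply/negP => /eqP Einf.
  have mu_0 x : mu x = 0.
    apply/eqP; rewrite eq_le mu0 andbT (le_trans (dp x)) //.
    by rewrite /discrete_gaussian -/E Einf /= invr0 !mulr0.
  move: mu1; rewrite esum1 => [/eqP|x _]; last by rewrite mu_0.
  by rewrite eqe eq_sym oner_eq0.
have EM : E = (fine E)%:E by rewrite fineK.
set M := fine E in EM.
pose m := \max_(x <- s) \max_(j < n) absz (x 0%R j).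
have xm x j : x \in s -> (absz (x 0%R j) <= m)%N.
  move=> xs; apply: (@leq_trans (\max_(j < n) absz (x 0%R j))); first exact: leq_bigmax.
  exact: (@leq_bigmax_seq _ s xpredT (fun x : 'rV[int]_n => \max_(j < n) absz (x 0%R j))).
have /andP[q0 q1] := q01.
have p01 : 0 <= q ^+ 2 < 1 by rewrite exprn_ge0 ?(ltW q0) //= exprn_ilt1 // ltW.
(* With this error Bernoulli's inequality over [m n] factors loses at most 1/4; the successor covers
   [m n = 0]. *)
pose eps : R := (4 * (m * n).+1%:R)^-1.
have eps0 : 0 < eps by rewrite invr_gt0 mulr_gt0.
have [N2 HN2] := eventually_expr_le p01 eps0.
exists (N2 + m)%N => N NN N0 G G0.
have mN : (m <= N)%N by rewrite (leq_trans _ NN) // leq_addl.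
have pe : (q ^+ 2) ^+ (N - m) <= eps by apply: HN2; rewrite -(leq_add2r m) subnK.
have pe0 : 0 <= (q ^+ 2) ^+ (N - m) by rewrite !exprn_ge0 // ltW.
have eps1 : eps * (m * n)%:R <= 1 / 4.
  rewrite /eps ler_pdivrMl ?mulr_gt0 //.
  have -> : 4 * (m * n).+1%:R * (1 / 4) = (m * n).+1%:R :> R by field.
  by rewrite ler_nat.
have bern : 3 / 4 <= (1 - (q ^+ 2) ^+ (N - m)) ^+ (m * n).
  have eps_le1 : eps <= 1 by rewrite /eps invf_le1 ?mulr_gt0 // -natrM ler1n.
  apply: le_trans (bernoulli_le _ _); last by rewrite pe0 (le_trans pe).
  rewrite (_ : 3 / 4 = 1 - 1 / 4); last by field.
  by rewrite lerD2l lerN2 (le_trans _ eps1) // mulrC ler_wpM2r.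
set ZN := \sum_f box_wt q f.
have ZN0 : 0 < ZN by exact: box_wt_sum_gt0.
have ZNM : ZN <= M by apply: box_wt_sum_le.
(* Each [x] is charged to a box index above it. After exchanging the sums, every index is charged at
   most once because [s] has no repetition. *)
have key x : x \in s -> mu x * G x <= \sum_(f : {ffun 'I_n -> 'I_N.*2.+1})
    (if box_pt f == x then alpha^-1 * (4 / 3) * (box_wt q f * G (box_pt f) / ZN) else 0).
  move=> xs; have [j|f fx] := @box_pt_onto N x; first by rewrite (leq_trans (xm _ _ xs)).
  rewrite (bigD1 f) //= fx eqxx ler_wpDr //.
    apply: sumr_ge0 => g _; case: ifP => // _.
    by rewrite !mulr_ge0 ?invr_ge0 ?(ltW ZN0) ?(ltW alpha0) ?box_wt_ge0.
  have -> : alpha^-1 * (4 / 3) * (box_wt q f * G x / ZN) =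
     alpha^-1 * (4 / 3 * box_wt q f / ZN) * G x by ring.
  apply: ler_wpM2r => //; apply: le_trans (dp x) _; rewrite ler_pM2l ?invr_gt0 //.
  rewrite /discrete_gaussian -/E -/M.
  have gw : gauss_weight r x <= 4 / 3 * box_wt q f.
    have := @box_wt_ge N N0 m f mN; rewrite fx => /(_ (fun j => xm x j xs)).
    have g0 : 0 <= gauss_weight r x by exact: expR_ge0.
    move=> /(le_trans (ler_wpM2l g0 bern)) h.
    by rewrite -ler_pdivrMl // invf_div mulrC.
  apply: ler_pM => //; rewrite ?expR_ge0 ?invr_ge0 ?(le_trans (ltW ZN0)) //.
  by rewrite lef_pV2 ?qualifE //= (lt_le_trans ZN0).
apply: (@le_trans _ _ (\sum_(x <- s) \sum_(f : {ffun 'I_n -> 'I_N.*2.+1})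
    (if box_pt f == x then alpha^-1 * (4 / 3) * (box_wt q f * G (box_pt f) / ZN) else 0))).
  by rewrite big_seq [leRHS]big_seq; apply: ler_sum => x; exact: key.
rewrite exchange_big /= mulr_suml mulr_sumr; apply: ler_sum => f _.
rewrite -big_mkcond /= big_const_seq iter_addr_0.
set c := (X in X *+ _).
have c0 : 0 <= c.
  by rewrite /c !mulr_ge0 ?invr_ge0 ?(ltW ZN0) ?(ltW alpha0) ?box_wt_ge0.
have : (count (fun x => box_pt f == x) s <= 1)%N.
  rewrite (eq_count (a2 := pred1 (box_pt f))); last by move=> x; rewrite /= eq_sym.
  by rewrite count_uniq_mem // leq_b1.
by case: (count _ _) => [|[|//]] _; rewrite ?mulr0n ?mulr1n.
Qed.

(** This sum is the decay rate in [box_char]. It equals [q (1 - q^(2 N)) / (1 - q^2)], whose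
    denominator is at most [8 / r^2] and whose numerator is eventually at least 8/10. *)
Lemma theta_variance_ge : 20 <= r ->
  exists N1, forall N, (N1 <= N)%N -> r ^+ 2 / 10 <= \sum_(i < N) q ^+ i.*2.+1.
Proof.
move=> r20; have /andP[q0 q1] := q01.
have p01 : 0 <= q ^+ 2 < 1 by rewrite exprn_ge0 ?(ltW q0) //= exprn_ilt1 // ltW.
have [N1 HN] := @eventually_expr_le (q ^+ 2) (1 / 10) p01 ltac:(lra).
exists N1 => N /HN pN.
have geo : (\sum_(i < N) q ^+ i.*2.+1) * (1 - q ^+ 2) = q * (1 - (q ^+ 2) ^+ N).
  elim: N {pN} => [|N IH]; first by rewrite big_ord0 mul0r expr0 subrr mulr0.
  rewrite big_ord_recr /= mulrDl IH (exprS q N.*2) -mul2n exprM (exprS (q ^+ 2) N).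
  by ring.
have r2 : 400 <= r ^+ 2.
  rewrite (_ : 400 = 20 ^+ 2); first by rewrite ler_sqr ?qualifE /=; lra.
  by rewrite -natrX.
have rr0 : 0 < r ^+ 2 by lra.
have pi4 : pi < 4 :> R by have := @pihalf_lt2 R; lra.
have lam : pi / r ^+ 2 <= 4 / r ^+ 2 by rewrite ler_pM2r ?invr_gt0 // ltW.
have lam2 : 4 / r ^+ 2 <= 1 / 100 by rewrite ler_pdivrMr //; lra.
have qge : 1 - pi / r ^+ 2 <= q by exact: expR_ge1Dx.
have pge : 1 - 2 * (4 / r ^+ 2) <= q ^+ 2.
  have : (1 - 4 / r ^+ 2) ^+ 2 <= q ^+ 2 by rewrite ler_sqr ?qualifE /=; lra.
  by have := sqr_ge0 (4 / r ^+ 2); rewrite sqrrB expr1n mul1r; lra.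
set Sg := \sum_(i < N) _ in geo *.
have S0 : 0 <= Sg by apply: sumr_ge0 => i _; rewrite exprn_ge0 // ltW.
have h1 : Sg * (1 - q ^+ 2) <= Sg * (2 * (4 / r ^+ 2)) by rewrite ler_wpM2l //; lra.
have h2 : 8 / 10 <= q * (1 - (q ^+ 2) ^+ N).
  have : (99 / 100) * (9 / 10) <= q * (1 - (q ^+ 2) ^+ N) by apply: ler_pM; lra.
  lra.
have : 8 / 10 <= Sg * 8 / r ^+ 2 by move: h1; rewrite geo; lra.
by rewrite ler_pdivlMr //; lra.
Qed.

(* The test function [\prod fejer] has [mu]-mean at least [2/3] because every
   [z] is in the large spectrum, whereas [fejer_prod_le] bounds its mean over
   the box measure, which dominates [3/4 alpha mu] on any given finite set. *)
Lemma separated_spectrum_bound (alpha K kap rho : R) (mu : 'rV[int]_n -> R) (L : nat) l :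
  20 <= r -> 0 < alpha -> 8 <= K -> 0 < rho -> (0 < L)%N ->
  prob_mass mu -> dense_piece alpha mu (discrete_gaussian r) ->
  separated [set z | large_spectrum K mu z /\ norm2 z <= kap] rho l ->
  (size l)%:R * (L%:R * kap) <= 1 / 2 -> (size l)%:R * L%:R ^+ 2 <= K / 16 ->
  alpha / 2 <= ((2 + 4 / (Num.sqrt (r ^+ 2 / 10) * rho)) / L%:R) ^+ size l.
Proof.
move=> r20 alpha0 K8 rho0 L0 pm dp sl lLk lLK.
have [mu0 mu1] := pm.
(* Missing mass [1 / (2 K)] costs [1 / K] in [spectrum_sum_ge], so each [z] has total defect at most
   [2 / K]. *)
have e0 : 0 < 1 / (2 * K) by rewrite divr_gt0 //; lra.
have [s us smu] := mass_approx e0 mu1.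
have smu1 : \sum_(x <- s) mu x <= 1 by rewrite -lee_fin -mu1 esum_ge_seq.
have [N1 HN1] := dense_piece_box_le alpha0 pm dp us.
have [N2 HN2] := theta_variance_ge r20.
have [N [N1N N2N N0]] : exists N, [/\ (N1 <= N)%N, (N2 <= N)%N & (0 < N)%N].
  by exists (N1 + N2).+1; split=> //; apply: leqW; rewrite ?leq_addl ?leq_addr.
have a0 : 0 < r ^+ 2 / 10 by rewrite divr_gt0 // exprn_gt0.
pose om z := phase (fourier mu z).
pose P x := \prod_(e <- l) fejer om L e.1 x.
have om1 z : normc (om z) = 1 by exact: normc_phase.
have P0 x : 0 <= P x by apply: prodr_ge0 => e _; case/andP: (fejer01 om1 L0 e.1 x).
pose ZN := \sum_(f : {ffun 'I_n -> 'I_N.*2.+1}) box_wt q f.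
have ZN0 : 0 < ZN by exact: box_wt_sum_gt0.
have char_le (D : 'rV[R]_n) : norm2 D <= 1 / 2 ->
    normc (\sum_(f : {ffun 'I_n -> 'I_N.*2.+1}) ((box_wt q f)%:C)%C * chi D (box_pt f)) <=
    ZN * expR (- (r ^+ 2 / 10 * dotv D D)).
  move=> D2; apply: le_trans (box_char q01 _ _) _ => //.
  rewrite -/ZN ler_pM2l // ler_expR lerN2.
  have h1 : r ^+ 2 / 10 <= \sum_(i < N) q ^+ i.*2.+1 by exact: HN2.
  (* The condition [norm2 D <= 1 / 2] keeps every coordinate where the quadratic bound on the cosine
     holds. *)
  have h2 : 4 * dotv D D <= \sum_j (1 - cos (2 * pi * D 0 j)).
    rewrite /dotv mulr_sumr; apply: ler_sum => j _; rewrite -expr2.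
    by apply: one_sub_cos2pi_ge; apply: le_trans D2; exact: norm2_coord.
  have -> : r ^+ 2 / 10 * dotv D D = r ^+ 2 / 10 / 4 * (4 * dotv D D) by field.
  apply: ler_pM => //.
  - exact: divr_ge0 (ltW a0) _.
  - by rewrite mulr_ge0 ?dotv_ge0.
  - by rewrite ler_pM2r.
have sl' : separated [set z | norm2 z <= kap] rho l.
  by elim: l sl {lLk lLK P P0} => //= -[z u] l IH [[_ ?] ? ? ? /IH].
have up := @fejer_prod_le R n om L om1 L0 _ (fun f => box_wt q f) (@box_pt n N) ZN _ rho kap
  (ltW ZN0) a0 rho0 char_le l 0 sl'.
have norm20 : norm2 (0 : 'rV[R]_n) = 0.
  by rewrite -(scale0r 0) norm2Z normr0 mul0r.
rewrite norm20 add0r in up; have {}up := up lLk.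
(* Truncation loses at most 1/16 and the Fejer defects at most [size l * L^2 * (2 / K) <= 1/8]. *)
have lo : 2 / 3 <= \sum_(x <- s) mu x * P x.
  pose Pz x := \sum_(e <- l) (1 - fejer om L e.1 x).
  have h1 : \sum_(x <- s) mu x * (1 - Pz x) <= \sum_(x <- s) mu x * P x.
    apply: ler_sum => x _; apply: ler_wpM2l => //.
    by apply: (@prod_ge_1Bsum R _ l (fun e => fejer om L e.1 x)) => e; exact: fejer01.
  apply: le_trans h1.
  have -> : \sum_(x <- s) mu x * (1 - Pz x) =
     \sum_(x <- s) mu x - \sum_(e <- l) \sum_(x <- s) mu x * (1 - fejer om L e.1 x).
    rewrite exchange_big /= -sumrB; apply: eq_bigr => x _.
    by rewrite mulrBr mulr1 mulr_sumr.
  have h2 : \sum_(e <- l) \sum_(x <- s) mu x * (1 - fejer om L e.1 x) <=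
      (size l)%:R * (L%:R ^+ 2 * (2 / K)).
    have : forall l', separated [set z | large_spectrum K mu z /\ norm2 z <= kap] rho l' ->
      \sum_(e <- l') \sum_(x <- s) mu x * (1 - fejer om L e.1 x) <=
      (size l')%:R * (L%:R ^+ 2 * (2 / K)); last by apply.
    elim=> [|[z u] l' IH]; first by rewrite big_nil mul0r.
    move=> [[Kz _] _ _ _ sl1]; rewrite big_cons [size _]/= -natr1 mulrDl mul1r addrC.
    apply: lerD; first exact: IH.
    apply: (@le_trans _ _ (\sum_(x <- s) mu x * (L%:R ^+ 2 * (1 - complex.Re (om z * chi z x))))).
      by apply: ler_sum => x _; apply: ler_wpM2l => //; exact: one_sub_fejer_le.
    have -> : \sum_(x <- s) mu x * (L%:R ^+ 2 * (1 - complex.Re (om z * chi z x))) =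
       L%:R ^+ 2 * (\sum_(x <- s) mu x - \sum_(x <- s) mu x * complex.Re (om z * chi z x)).
      by rewrite -sumrB mulr_sumr; apply: eq_bigr => x _; ring.
    apply: ler_wpM2l; first exact: sqr_ge0.
    have := spectrum_sum_ge pm Kz us; rewrite -/(om z).
    have -> : 2 / K = 1 / K + 2 * (1 / (2 * K)) by field; apply/eqP; lra.
    by move: smu smu1; lra.
  have h3 : (size l)%:R * (L%:R ^+ 2 * (2 / K)) <= 1 / 8.
    rewrite mulrA mulrA ler_pdivrMr; last by lra.
    by move: lLK; lra.
  have h4 : 1 / (2 * K) <= 1 / 16 by rewrite ler_pdivrMr; lra.
  by move: smu h2; lra.
have mid := HN1 N N1N N0 P P0.
move: up; set V := (\sum_f _ * _ * _).
have -> : V = ((\sum_(f : {ffun 'I_n -> 'I_N.*2.+1}) box_wt q f * P (box_pt f))%:C)%C.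
  rewrite rmorph_sum /=; apply: eq_bigr => f _.
  have -> : chi 0 (box_pt f) = 1 :> R[i].
    by rewrite /chi -(scale0r 0) dotvZl mul0r mulr0 oppr0 expi0.
  by rewrite mulr1 -rmorphM.
set W := \sum_f _.
have W0 : 0 <= W by apply: sumr_ge0 => f _; rewrite mulr_ge0 ?box_wt_ge0.
rewrite normc_real ger0_norm //; set F := _ ^+ size l => up.
have F0 : 0 <= F.
  by rewrite exprn_ge0 // divr_ge0 // addr_ge0 // divr_ge0 // mulr_ge0 ?sqrtr_ge0 // ltW.
have WF : W <= ZN * F.
  apply: le_trans up _; rewrite -[leRHS]mulr1 ler_wpM2l ?mulr_ge0 ?(ltW ZN0) //.
  by rewrite -[leRHS]expR0 ler_expR oppr_le0 (mulr_ge0 (ltW a0) (dotv_ge0 _)).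
have WF' : W / ZN <= F by rewrite ler_pdivrMr // mulrC.
have : 2 / 3 <= alpha^-1 * (4 / 3) * F.
  apply: (le_trans lo); apply: (le_trans mid); rewrite -/ZN -/W ler_wpM2l //.
  by rewrite mulr_ge0 // invr_ge0 ltW.
rewrite -mulrA ler_pdivlMl //; lra.
Qed.

End DiscreteGaussian.

(** * Rounding an orthonormal basis to the grid, and torus distances *)

Section Rounding.
Context {R : realType} {n : nat}.
Implicit Types (u w D : 'rV[R]_n) (us : seq 'rV[R]_n).

(** A nearest grid point to [u / 4]: for a unit vector the coordinates are then at most 1/4 in size,
    which leaves room for the rounding error inside the cube, and the spanned line ignores the
    scale. *)
Definition grid_round (Q : R) u : 'rV[R]_n :=
  Q^-1 *: intvec (\row_j Num.floor (Q * (u 0 j / 4) + 1 / 2)).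

Lemma grid_round_coord (Q : R) u j : 0 < Q ->
  `|grid_round Q u 0 j - u 0 j / 4| <= 1 / 2 / Q.
Proof.
move=> Q0; rewrite !mxE; set y := Q * (u 0 j / 4) + 1 / 2.
have /andP[f1 f2] : (Num.floor y)%:~R <= y < (Num.floor y + 1)%:~R by exact: floor_itv.
have -> : Q^-1 * (Num.floor y)%:~R - u 0 j / 4 = ((Num.floor y)%:~R - Q * (u 0 j / 4)) / Q.
  by field; rewrite gt_eqF.
rewrite normrM normfV (gtr0_norm Q0) ler_pM2r ?invr_gt0 //.
by rewrite intrD in f2; rewrite ler_norml; move: f1 f2; rewrite /y; lra.
Qed.

Lemma grid_round_cube (Q : R) u : 2 < Q -> norm2 u <= 1 -> cube_grid Q (grid_round Q u).
Proof.
move=> Q2 u1; split; first by eexists.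
move=> j; have Q0 : 0 < Q by lra.
have := grid_round_coord u j Q0; have := le_trans (norm2_coord u j) u1.
have : 1 / 2 / Q < 1 / 4 by rewrite ltr_pdivrMr //; lra.
by rewrite !ler_norml => ? /andP[? ?] /andP[? ?]; apply/andP; split; lra.
Qed.

Lemma grid_round_err (Q : R) u : 0 < Q ->
  norm2 (u - 4 *: grid_round Q u) <= 2 * Num.sqrt n%:R / Q.
Proof.
move=> Q0; rewrite -ler_sqr ?qualifE /= ?norm2_ge0 //; last first.
  by rewrite divr_ge0 ?mulr_ge0 ?sqrtr_ge0 // ltW.
rewrite norm2_sqr.
have -> : (2 * Num.sqrt n%:R / Q) ^+ 2 = \sum_(j < n) (2 / Q) ^+ 2 :> R.
  rewrite sumr_const card_ord -[RHS]mulr_natr.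
  transitivity ((2 / Q) ^+ 2 * Num.sqrt n%:R ^+ 2 : R); first by ring.
  by rewrite sqr_sqrtr.
apply: ler_sum => j _; rewrite -expr2 -real_normK ?num_real //.
rewrite ler_sqr ?qualifE /= ?normr_ge0 ?divr_ge0 ?(ltW Q0) //.
have := grid_round_coord u j Q0; rewrite !mxE; set g := Q^-1 * _.
have -> : 2 / Q = 4 * (1 / 2 / Q) by field; rewrite gt_eqF.
by rewrite !ler_norml => /andP[? ?]; apply/andP; split; lra.
Qed.

(** The inductive step of Cauchy-Schwarz, with [T] a sum of [k] numbers and [S] the sum of their
    squares. *)
Lemma sqrD_le_natS (k : nat) (T c S : R) : 0 <= S -> T ^+ 2 <= k%:R * S ->
  (T + c) ^+ 2 <= (k%:R + 1) * (S + c ^+ 2).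
Proof.
move=> S0; case: k => [|k] TS.
  have /eqP : T ^+ 2 = 0 by apply/eqP; rewrite eq_le sqr_ge0 andbT (le_trans TS) ?mul0r.
  by rewrite sqrf_eq0 => /eqP ->; rewrite !add0r mul1r lerDr.
have k0 : 0 < k.+1%:R :> R by rewrite ltr0n.
move: (k.+1%:R) k0 TS => {}k k0 TS; rewrite -(ler_pM2l k0).
have := sqr_ge0 (T - k * c); have := ler_wpM2l (ltW (ltr_wpDr ler01 k0)) TS.
rewrite -subr_ge0 => h1 h2; rewrite -subr_ge0.
have -> : k * ((k + 1) * (S + c ^+ 2)) - k * (T + c) ^+ 2 =
  ((k + 1) * (k * S) - (k + 1) * T ^+ 2) + (T - k * c) ^+ 2 by ring.
exact: addr_ge0.
Qed.

(** Replace each [u] by [4 app u] in the combination that the residual subtracts. The error is [eps]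
    times the sum [T] of the absolute coefficients; their squares add up to the loss of squared norm
    by Pythagoras, and Cauchy-Schwarz bounds [T]. *)
Lemma residual_span_approx (app : 'rV[R]_n -> 'rV[R]_n) (eps : R) us D :
  (forall u, u \in us -> dotv u u = 1 /\ norm2 (u - 4 *: app u) <= eps) ->
  exists w T, [/\ w \in <<map app us>>%VS, 0 <= T,
    norm2 (D - w - residual us D) <= eps * T,
    0 <= dotv D D - dotv (residual us D) (residual us D) &
    T ^+ 2 <= (size us)%:R * (dotv D D - dotv (residual us D) (residual us D))].
Proof.
elim: us => [|u us IH] usP.
  exists 0, 0; rewrite mem0v mulr0 expr0n mul0r subrr; split=> //=.
  by rewrite subr0 subrr -(scale0r 0) norm2Z normr0 mul0r.
have [|w [T [wus T0 wT rD TS]]] := IH.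
  by move=> v vus; apply: usP; rewrite inE vus orbT.
have [u1 ue] := usP u (mem_head _ _).
set c := dotv (residual us D) u.
have E : dotv D D - dotv (residual (u :: us) D) (residual (u :: us) D) =
    dotv D D - dotv (residual us D) (residual us D) + `|c| ^+ 2.
  by rewrite (residual_pythagoras us D u1) -/c real_normK ?num_real //; ring.
exists (w + (c * 4) *: app u), (T + `|c|); split.
- rewrite span_cons memvD ?memvZ //.
    by apply: subvP wus; exact: addvSr.
  by apply: subvP (memv_line _); exact: addvSl.
- by rewrite addr_ge0.
- rewrite /= -/c.
  have -> : D - (w + (c * 4) *: app u) - (residual us D - c *: u) =
      (D - w - residual us D) + c *: (u - 4 *: app u).
    by apply/rowP => j; rewrite !mxE; ring.
  apply: le_trans (norm2D _ _) _; rewrite mulrDr lerD // norm2Z mulrC.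
  by rewrite ler_wpM2r.
- by rewrite E addr_ge0 // sqr_ge0.
- by rewrite E [size _]/= -natr1; exact: sqrD_le_natS.
Qed.

Lemma torus_norm_le (z : 'rV[R]_n) (k : 'rV[int]_n) : torus_norm z <= norm2 (z - intvec k).
Proof.
apply: ge_inf; last by exists k.
by exists 0 => _ [y _ <-]; exact: norm2_ge0.
Qed.

Lemma torus_norm_rep (z : 'rV[R]_n) (x : R) : torus_norm z < x ->
  exists k, norm2 (z - intvec k) <= x.
Proof.
move=> /inf_lt[|_ [k _ <-] kx]; last by exists k; exact: ltW.
by exists (norm2 (z - intvec 0)); exists 0.
Qed.

Lemma torus_dist_le (z w : 'rV[R]_n) (W : {vspace 'rV[R]_n}) : w \in W ->
  torus_dist z W <= torus_norm (z - w).
Proof.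
move=> wW; apply: ge_inf; last by exists w.
exists 0 => _ [y _ <-]; apply: lb_le_inf.
  by exists (norm2 (z - y - intvec 0)); exists 0.
by move=> _ [k _ <-]; exact: norm2_ge0.
Qed.

End Rounding.

(** * Numerical constants and the size of the Fejer factor *)

Section Constants.
Context {R : realType}.

Lemma log2_ge1 (x : R) : 2 <= x -> 1 <= log2 x.
Proof.
move=> x2; have l2 : 0 < ln 2 :> R by rewrite ln_gt0 // ltr1n.
by rewrite /log2 ler_pdivlMr // mul1r ler_ln ?qualifE //=; lra.
Qed.

Lemma powR_three_halves (x : R) : 0 < x -> x `^ (3 / 2) = Num.sqrt x ^+ 3.
Proof.
move=> x0; have -> : 3 / 2 = 1 + 2^-1 :> R by field.
rewrite powRD; last by rewrite gt_eqF ?implybT.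
by rewrite powRr1 ?(ltW x0) // powR12_sqrt ?(ltW x0) // exprSr sqr_sqrtr // ltW.
Qed.

Lemma ln8n_ge2 (n : nat) : (0 < n)%N -> 2 <= ln (8 * n%:R) :> R.
Proof.
move=> n0; have n1 : 1 <= n%:R :> R by rewrite ler1n.
rewrite -ler_expR lnK ?qualifE /=; last by apply: mulr_gt0; lra.
apply: (@le_trans _ _ 8); last by lra.
suff : 1 / 8 <= expR (- 2) :> R.
  rewrite expRN ler_pdivrMr // mulrC -ler_pdivrMr ?invr_gt0 ?expR_gt0 //.
  by rewrite mul1r invrK.
(* Numerically [exp (-2) >= (15/16)^32 >= 1/8]. *)
have y1 : 15 / 16 <= expR (- (1 / 16)) :> R by have := @expR_ge1Dx R (- (1 / 16)); lra.
have -> : expR (- 2) = expR (- (1 / 16)) ^+ 32 :> R.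
  by rewrite -expRM_natl; congr expR; field.
apply: le_trans (lerXn2r 32 _ _ y1); rewrite ?qualifE /= ?expR_ge0 //; last by lra.
Qed.
End Constants.

(* With [s = sqrt S] and [k = sqrt K], the constant [100] in [rho] is what makes
   the factor of [separated_spectrum_bound] at most [1 / (2 B)]. *)
Lemma fejer_factor_le (R : realType) (r kappa B s k rho L m : R) :
  0 < r -> 0 < kappa -> 1 <= B -> 1 <= s -> 3 * s / r <= kappa ->
  rho = 100 * B * s ^+ 3 * kappa / k -> 200 * B * s ^+ 3 < k ->
  0 < m -> m <= 2 * s ^+ 2 -> k / (42 / 10 * m) - 1 < L ->
  (2 + 4 / (Num.sqrt (r ^+ 2 / 10) * rho)) / L <= (2 * B)^-1.
Proof.
move=> r0 ka0 B1 s1 rk rhoE kB m0 mS Lm; have c300 : 0 < 300 :> R by rewrite ltr0n.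
have c100 : 0 < 100 :> R by rewrite ltr0n.
have s20 : 1 <= s ^+ 2 by rewrite expr_ge1 //; lra.
have s30 : 1 <= s ^+ 3 by rewrite expr_ge1 //; lra.
have B0 : 0 < B by lra.
have Bs0 : 0 < B * s ^+ 3 by apply: mulr_gt0; lra.
have k0 : 0 < k by lra.
have rho0 : 0 < rho.
  by rewrite rhoE divr_gt0 // !mulr_gt0 //; lra.
have rk3 : 3 * s <= kappa * r by rewrite -ler_pdivrMr.
have sq : r * (3 / 10) <= Num.sqrt (r ^+ 2 / 10).
  rewrite -[leLHS]ger0_norm; last by apply: mulr_ge0; lra.
  rewrite -sqrtr_sqr ler_wsqrtr // exprMn ler_pM2l ?exprn_gt0 //.
  by clear; lra.
have rrho : 300 * (B * s ^+ 4 / k) <= r * rho.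
  rewrite rhoE (_ : r * _ = (kappa * r) * (100 * (B * s ^+ 3) / k)); last by ring.
  have -> : 300 * (B * s ^+ 4 / k) = (3 * s) * (100 * (B * s ^+ 3) / k) by ring.
  by apply: ler_wpM2r rk3; rewrite ltW // (divr_gt0 (mulr_gt0 c100 Bs0) k0).
have s40 : 0 < s ^+ 4 by apply: exprn_gt0; lra.
have Bs4 : 0 < 300 * (B * s ^+ 4 / k).
  exact: mulr_gt0 c300 (divr_gt0 (mulr_gt0 B0 s40) k0).
have h1 : 4 / (Num.sqrt (r ^+ 2 / 10) * rho) <= 4 / (3 / 10 * (300 * (B * s ^+ 4 / k))).
  rewrite ler_pM2l // lef_pV2 ?qualifE /=; last 2 first.
  - by rewrite mulr_gt0 // (lt_le_trans _ sq) // mulr_gt0 // divr_gt0.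
  - by rewrite mulr_gt0 // divr_gt0.
  apply: (@le_trans _ _ (r * (3 / 10) * rho)); last by rewrite ler_pM2r.
  have -> : r * (3 / 10) * rho = 3 / 10 * (r * rho) by ring.
  by rewrite ler_pM2l // divr_gt0.
have h2 : 4 / (3 / 10 * (300 * (B * s ^+ 4 / k))) * (2 * B) = 4 / 45 * (k / s ^+ 4).
  by field; rewrite !gt_eqF //; lra.
(* Everything is compared with [y >= 200 B]: the numerator times [2 B] is at most
   [y / 50 + 4 y / 45], while [L > y / 8.4 - 1]. *)
set y := k / s ^+ 2.
have s2p : 0 < s ^+ 2 by lra.
have y0 : 0 < y by rewrite divr_gt0.
have h3 : k / s ^+ 4 <= y.
  rewrite /y ler_pM2l // lef_pV2 ?qualifE //= (_ : s ^+ 4 = s ^+ 2 * s ^+ 2); last by ring.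
  by rewrite ler_peMr //; lra.
have h4 : 200 * B <= y.
  rewrite /y ler_pdivlMr //; apply: le_trans (ltW kB).
  by apply: ler_wpM2l; [exact: mulr_ge0 (ler0n _ _) (ltW B0) | rewrite ler_weXn2l].
have h5 : y / (84 / 10) - 1 < L.
  apply: le_lt_trans Lm; rewrite lerD2r /y.
  have -> : k / s ^+ 2 / (84 / 10) = k / (42 / 10 * (2 * s ^+ 2)).
    by field; rewrite !gt_eqF //; lra.
  by rewrite ler_pM2l // lef_pV2 ?qualifE /= ?ler_pM2l ?mulr_gt0 //; lra.
have L0 : 0 < L by lra.
have B20 : 0 < 2 * B by rewrite mulr_gt0.
rewrite ler_pdivrMr // ler_pdivlMl // mulrC mulrDl.
by have := ler_wpM2r (ltW B20) h1; rewrite h2; move: h3 h4 h5 B1; clear; lra.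
Qed.

(** * Choice of parameters, greedy selection and rounding *)

Theorem theorem4p4p2 (R : realType) (n : nat) (r K alpha kappa B Q : R)
    (mu : 'rV[int]_n -> R) :
  (0 < n)%N ->
  2 <= r -> 2 <= K -> 0 < alpha <= 1 -> 0 < kappa -> 1 <= B ->
  prob_mass mu ->
  dense_piece alpha mu (discrete_gaussian r) ->
  let S := log2 (2 / alpha) in
  let rho := 100 * B * S `^ (3 / 2) * kappa / Num.sqrt K in
  3 * Num.sqrt S / r <= kappa ->
  kappa <= Num.sqrt (2 * pi / (K * ln (8 * n%:R))) ->
  2 * Num.sqrt (2 * n%:R * S) * kappa / rho <= Q ->
  exists (l : nat) (eta : l.-tuple 'rV[R]_n),
    [/\ forall i : 'I_l, cube_grid Q (tnth eta i),
        l%:R <= 2 * S / log2 (2 * B)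
      & forall zeta : 'rV[R]_n,
          large_spectrum K mu zeta -> torus_norm zeta <= kappa ->
          torus_dist zeta <<eta>>%VS <= 2 * rho].
Proof.
move=> n0 r2 K2 /andP[alpha0 alpha1] ka0 B1 pm dp S rho rka kaK QK.
have S1 : 1 <= S by apply: log2_ge1; rewrite ler_pdivlMr //; lra.
have S0 : 0 < S by lra.
have lB1 : 1 <= log2 (2 * B) by apply: log2_ge1; lra.
set s := Num.sqrt S in rka; set k := Num.sqrt K.
have sS : s ^+ 2 = S by rewrite sqr_sqrtr // ltW.
have kK : k ^+ 2 = K by rewrite sqr_sqrtr //; lra.
have s1 : 1 <= s by rewrite -[leLHS]sqrtr1 ler_wsqrtr.
have k0 : 0 < k by rewrite sqrtr_gt0; lra.
have rhoE : rho = 100 * B * s ^+ 3 * kappa / k by rewrite /rho powR_three_halves.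
have B0 : 0 < B by lra.
have s30 : 1 <= s ^+ 3 by rewrite expr_ge1 //; lra.
have rho0 : 0 < rho by rewrite rhoE divr_gt0 // !mulr_gt0 //; lra.
have SB0 : 0 <= S / log2 (2 * B) by rewrite divr_ge0 //; lra.
(* If [kappa <= 2 rho], the empty family works with the origin as nearest point. Otherwise
   [sqrt K > 200 B S^(3/2)], which makes [K] and then [r] large. *)
have [ka_rho|rho_ka] := leP kappa (2 * rho).
  exists 0%N, [tuple]; split=> [[]//||z _ zk].
    by rewrite -mulrA mulr_ge0.
  apply: le_trans ka_rho; apply: le_trans zk.
  by have := @torus_dist_le R n z 0 _ (mem0v <<[tuple]>>%VS); rewrite subr0.
have kB : 200 * B * s ^+ 3 < k.
  move: rho_ka; rewrite rhoE mulrA ltr_pdivrMr // [kappa * k]mulrC.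
  have -> : 2 * (100 * B * s ^+ 3 * kappa) = 200 * B * s ^+ 3 * kappa by ring.
  by rewrite ltr_pM2r.
have Bs0 : 1 <= B * s ^+ 3 by rewrite -[1]mulr1 ler_pM.
have k200 : 200 < k by lra.
(* From the upper hypothesis on [kappa], with [ln (8 n) >= 2] and [pi < 4]. *)
have kap2 : kappa <= 2 / k.
  apply: (le_trans kaK); have -> : 2 / k = Num.sqrt (4 / K).
    rewrite -kK (_ : 4 / k ^+ 2 = (2 / k) ^+ 2) ?sqrtr_sqr ?gtr0_norm ?divr_gt0 //.
    by field; rewrite gt_eqF.
  have l2 := @ln8n_ge2 R n n0; have pi4 : pi < 4 :> R by have := @pihalf_lt2 R; lra.
  have K0 : 0 < K by lra.
  rewrite ler_wsqrtr // ler_pdivrMr ?mulr_gt0 //; last by lra.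
  rewrite mulrA divfK ?gt_eqF //; lra.
have kak : kappa * k <= 2 by rewrite -ler_pdivlMr.
have r0 : 0 < r by lra.
have r20 : 20 <= r.
  have : 3 * s <= kappa * r by rewrite -ler_pdivrMr.
  have : kappa * 200 <= kappa * k by rewrite ler_pM2l // ltW.
  move=> h1 h2; have ka1 : kappa <= 1 / 100 by lra.
  by have := ler_wpM2r (ltW r0) ka1; lra.
have K8 : 8 <= K.
  have k1 : 1 <= k by move: k200; clear; lra.
  have : k <= k * k by rewrite ler_peMr // ltW.
  by rewrite -kK expr2; move: k200; clear; lra.
(* The torus norm is an infimum; the factor 21/20 leaves slack to pick a representative. *)
pose X := [set z | large_spectrum K mu z /\ norm2 z <= 21 / 20 * kappa].
have SB : S / log2 (2 * B) <= S by rewrite ler_pdivrMr ?ler_peMr //; lra.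
(* The least integer above [S / log2 (2 B)]: a separated family of this size is impossible, and a
   shorter one meets the bound with a factor 2 to spare. *)
have [M [Mp MgtS MleS]] : exists M, [/\ (0 < M)%N, S / log2 (2 * B) < M%:R &
    M%:R <= S / log2 (2 * B) + 1].
  exists (Num.truncn (S / log2 (2 * B))).+1; split=> //; first exact: truncnS_gt.
  by rewrite -natr1 lerD2r truncn_le.
have M2S : M%:R <= 2 * s ^+ 2 by rewrite sS; move: MleS SB S1; clear; lra.
have M0 : 0 < M%:R :> R by rewrite ltr0n.
have M1 : 1 <= M%:R :> R by rewrite ler1n.
have [[l lM sl]|[l [lM sl cl]]] := greedy_separated X M rho0.
  (* With [L] the integer part of [x], one has [L M <= k / 4.2]. As [kappa k <= 2], this gives
     [M L (21/20) kappa <= 1/2], and [M L^2 <= K / 4.2^2 <= K / 16]. *)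
  exfalso; set x := k / (42 / 10 * M%:R).
  have x1 : 1 <= x.
    rewrite /x ler_pdivlMr ?mulr_gt0 // mul1r.
    have : s ^+ 2 <= B * s ^+ 3.
      by rewrite -[s ^+ 2]mul1r ler_pM ?sqr_ge0 ?ler_weXn2l //; lra.
    by rewrite sS; move: M2S kB; rewrite sS; lra.
  have xL : x < (Num.truncn x).+1%:R by exact: truncnS_gt.
  have Lx : (Num.truncn x)%:R <= x by rewrite truncn_le; lra.
  have L0 : (0 < Num.truncn x)%N by rewrite truncn_gt0.
  move: (Num.truncn x) L0 Lx xL => L L0 Lx xL.
  have LM : L%:R * M%:R <= k / (42 / 10).
    have -> : k / (42 / 10) = x * M%:R by rewrite /x; field; rewrite !gt_eqF.
    by rewrite ler_pM2r.
  have := @separated_spectrum_bound R n r r0 alpha K (21 / 20 * kappa) rho mu L l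
    r20 alpha0 K8 rho0 L0 pm dp sl; rewrite lM.
  move=> /(_ _ _) bound.
  have {}bound : alpha / 2 <= ((2 + 4 / (Num.sqrt (r ^+ 2 / 10) * rho)) / L%:R) ^+ M.
    apply: bound.
      have := ler_wpM2l (ltW ka0) LM; lra.
    have -> : M%:R * L%:R ^+ 2 = (L%:R * M%:R) * L%:R :> R by ring.
    have LLM : L%:R <= L%:R * M%:R :> R by rewrite ler_peMr.
    have : (L%:R * M%:R) * L%:R <= (k / (42 / 10)) * (k / (42 / 10)).
      by apply: ler_pM => //; rewrite ?mulr_ge0 //; apply: le_trans LM.
    move=> h; apply: (le_trans h); rewrite -kK; have := sqr_ge0 k; lra.
  have xL' : k / (42 / 10 * M%:R) - 1 < L%:R by rewrite -/x ltrBlDr natr1.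
  have fle := fejer_factor_le r0 ka0 B1 s1 rka rhoE kB M0 M2S xL'.
  have f0 : 0 <= (2 + 4 / (Num.sqrt (r ^+ 2 / 10) * rho)) / L%:R.
    by rewrite divr_ge0 // addr_ge0 // divr_ge0 // mulr_ge0 ?sqrtr_ge0 // ltW.
  have BM : alpha / 2 <= (2 * B) ^- M.
    apply: (le_trans bound); rewrite -exprVn; apply: lerXn2r => //.
      by rewrite qualifE /= invr_ge0; lra.
  have B20 : 0 < 2 * B by rewrite mulr_gt0.
  have {}BM : (2 * B) ^+ M <= 2 / alpha.
    rewrite -(invf_div alpha 2) -[leLHS]invrK lef_pV2 ?qualifE //= ?divr_gt0 //.
    by rewrite invr_gt0 exprn_gt0.
  (* Logarithms give [M log2 (2 B) <= S], against the choice of [M]. *)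
  have : ln ((2 * B) ^+ M) <= ln (2 / alpha).
    by rewrite ler_ln ?qualifE //= ?exprn_gt0 ?divr_gt0.
  rewrite lnXn // -[_ *+ M]mulr_natl => lnB.
  have l2 : 0 < ln 2 :> R by rewrite ln_gt0 // ltr1n.
  move: MgtS; rewrite ltr_pdivrMr ?(lt_le_trans ltr01) // ltNge; case/negP.
  by rewrite /S /log2 mulrA ler_pM2r ?invr_gt0.
have lS : (size l)%:R <= S / log2 (2 * B).
  by rewrite -(lerD2r 1) natr1 (le_trans _ MleS) // ler_nat.
have lS' : (size l)%:R <= S.
  exact: le_trans SB.
have n1 : 1 <= n%:R :> R by rewrite ler1n.
pose sn : R := Num.sqrt n%:R.
have sn1 : 1 <= sn by rewrite -[leLHS]sqrtr1 ler_wsqrtr.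
(* The factor [sqrt 2] in the hypothesis on [Q] absorbs the slack 21/20. *)
have nS : sn * s * (21 / 20) <= Num.sqrt (2 * n%:R * S).
  rewrite -[leLHS]ger0_norm; last by rewrite !mulr_ge0 ?sqrtr_ge0 ?divr_ge0.
  rewrite -sqrtr_sqr ler_wsqrtr //.
  have -> : (sn * s * (21 / 20)) ^+ 2 = (sn ^+ 2 * s ^+ 2) * (441 / 400) by field.
  rewrite sS sqr_sqrtr ?ler0n //.
  have : 0 <= n%:R * S by rewrite mulr_ge0 // ltW.
  by clear; lra.
have Q2 : 2 * sn * s * (21 / 20) * kappa / rho <= Q.
  apply: le_trans QK; rewrite ler_pM2r ?invr_gt0 // ler_pM2r //.
  by have := ler_wpM2l (ler0n R 2) nS; lra.
have Q4 : 4 < Q.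
  apply: lt_le_trans Q2; rewrite ltr_pdivlMr //.
  have sns : 1 <= sn * s by rewrite -[1]mulr1 ler_pM.
  by have := ler_wpM2r (ltW ka0) sns; lra.
have Q0 : 0 < Q by lra.
have usP u : u \in unzip2 l -> dotv u u = 1.
  by elim: l sl {lM cl lS lS'} => //= -[z v] l IH [_ v1 _ _ /IH{}IH];
     rewrite inE => /orP[/eqP->//|/IH].
exists (size (map (grid_round Q) (unzip2 l))), (in_tuple (map (grid_round Q) (unzip2 l))).
split.
- move=> i; have := mem_tnth i (in_tuple (map (grid_round Q) (unzip2 l))).
  move=> /mapP[u ul ->]; apply: grid_round_cube; first by move: Q4; clear; lra.
  by rewrite norm2E (usP u ul) sqrtr1.
- rewrite !size_map (le_trans lS) // -mulrA.
  by move: (S / log2 (2 * B)) SB0 => t; clear; lra.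
move=> z Kz zk.
have [|y yz] := @torus_norm_rep R n z (21 / 20 * kappa); first by lra.
set z' := z - intvec y in yz.
have Kz' : large_spectrum K mu z'.
  have Ez : fourier mu z' = fourier mu z by rewrite -(fourier_periodic mu z' y) subrK.
  by change (1 - 1 / K <= Normc.normc (fourier mu z')); rewrite Ez.
have rz : norm2 (residual (unzip2 l) z') <= rho by apply: cl.
have [|w [T [wl T0 wT rD TS]]] :=
    @residual_span_approx R n (grid_round Q) (2 * sn / Q) (unzip2 l) z'.
  by move=> u ul; split; [exact: usP | exact: grid_round_err].
apply: le_trans (torus_dist_le _ wl) _; apply: le_trans (torus_norm_le _ y) _.
have -> : z - w - intvec y = (z' - w - residual (unzip2 l) z') + residual (unzip2 l) z'.
  by rewrite subrK /z' addrAC.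
apply: le_trans (norm2D _ _) _.
(* One [rho] is the greedy residual; the other is left for the rounding error. *)
suff : 2 * sn / Q * T <= rho by move: wT rz; clear; lra.
have Tle : T <= s * (21 / 20 * kappa).
  rewrite -ler_sqr ?qualifE //=; last by rewrite !mulr_ge0 ?sqrtr_ge0 ?(ltW ka0).
  apply: (le_trans TS); rewrite size_map exprMn sS; apply: ler_pM => //.
  apply: (@le_trans _ _ (dotv z' z')); first by rewrite gerBl dotv_ge0.
  rewrite -norm2_sqr ler_sqr ?qualifE /= ?norm2_ge0 //.
  exact: le_trans (norm2_ge0 _) yz.
rewrite mulrAC ler_pdivrMr //.
apply: (@le_trans _ _ (2 * sn * (s * (21 / 20 * kappa)))).
  by rewrite ler_wpM2l // mulr_ge0 ?sqrtr_ge0.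
by move: Q2; rewrite ler_pdivrMr //; clear; lra.
Qed.
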